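(* The Bargmann-Fock-Fueter transform, $\varphi\mapsto\breve{f_\varphi}$ with $f_\varphi=\mathcal{B}_{\mathbb{H}}\varphi$, is the operator $\mathcal{S}_{\mathbb{H}}:=\tau\circ\mathrm{Id}\circ\mathcal{B}_{\mathbb{H}}: L^2_{\mathbb{H}}(\mathbb{R})\to\mathcal{A}(\mathbb{H})$, where $\mathcal{B}_{\mathbb{H}}:L^2_{\mathbb{H}}(\mathbb{R})\to\mathcal{F}_{Slice}(\mathbb{H})$, $\mathrm{Id}:\mathcal{F}_{Slice}(\mathbb{H})\to\mathcal{SR}(\mathbb{H})$ is the inclusion, and $\tau=\Delta$. More precisely, for every $\varphi\in L^2_{\mathbb{H}}(\mathbb{R})$ and $q\in\mathbb{H}$ (and any $I\in\mathbb{S}$ used to define $\breve{f_\varphi}$), $$\mathcal{S}_{\mathbb{H}}\varphi(q)=\breve{f_\varphi}(q)=\int_{\mathbb{R}}\Phi(q,x)\varphi(x)\,dx,$$ where $$\Phi(q,x)=-\frac{1}{\pi^{1/4}}\sum_{k=0}^\infty\frac{Q_k(q)\,h_{k+2}(x)}{2^{k/2}\,k!},\qquad (q,x)\in\mathbb{H}\times\mathbb{R}.$$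
   Context: $\mathbb{H}$ denotes the quaternions, $\mathbb{S}=\{I\in\mathbb{H}:I^2=-1\}$, $\mathbb{C}_I=\mathbb{R}+\mathbb{R}I$. $\mathcal{SR}(\mathbb{H})$ is the set of (left) slice hyperholomorphic functions $f:\mathbb{H}\to\mathbb{H}$: real differentiable with $(\partial_x+I\partial_y)f(x+Iy)=0$ on $\mathbb{C}_I$ for every $I\in\mathbb{S}$. With $d\mu_I(p)=\frac1\pi e^{-|p|^2}d\lambda_I(p)$, $d\lambda_I$ Lebesgue measure on $\mathbb{C}_I$, the slice Fock space is $\mathcal{F}_{Slice}(\mathbb{H})=\{f\in\mathcal{SR}(\mathbb{H}):\int_{\mathbb{C}_I}|f(p)|^2d\mu_I(p)<\infty\}$ (independent of $I$). $L^2_{\mathbb{H}}(\mathbb{R})$ is the space of square integrable $\mathbb{H}$-valued functions on $\mathbb{R}$. The quaternionic Segal-Bargmann transform is $\mathcal{B}_{\mathbb{H}}\varphi(q)=\int_{\mathbb{R}}A(q,x)\varphi(x)dx$ with $A(q,x)=\pi^{-1/4}e^{-\frac12(q^2+x^2)+\sqrt2qx}$; it is known to be an isometry of $L^2_{\mathbb{H}}(\mathbb{R})$ onto $\mathcal{F}_{Slice}(\mathbb{H})$. The Fueter mapping is $\tau(f)=\Delta f$, $\Delta$ the Laplacian on $\mathbb{R}^4\cong\mathbb{H}$, and $\mathcal{A}(\mathbb{H})=\tau(\mathcal{F}_{Slice}(\mathbb{H}))$. The Fock-Fueter kernel is $K_{\mathcal{F}}(q,p)=\Delta_q\sum_{k\ge0}\frac{q^k\overline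 p^k}{k!}$, and the Fock-Fueter transform of $f\in\mathcal{F}_{Slice}(\mathbb{H})$ is $\breve f(q)=\int_{\mathbb{C}_I}K_{\mathcal{F}}(q,p)f(p)d\mu_I(p)$. Further, $Q_k(q)=\sum_{j=0}^k\frac{2(k-j+1)}{(k+1)(k+2)}q^{k-j}\overline q^{\,j}$, and $h_k(x)=(-1)^ke^{x^2/2}\frac{d^k}{dx^k}e^{-x^2}$ are the Hermite functions, with $\|h_k\|^2_{L^2}=2^kk!\sqrt\pi$. *)

(* Defs.v *)
From HB Require Import structures.
From mathcomp Require Import all_boot all_order all_algebra.
From mathcomp Require Import all_classical all_reals all_analysis.
From mathcomp Require Import ring.
Set Implicit Arguments.
Unset Strict Implicit.
Unset Printing Implicit Defensive.
Import Order.TTheory GRing.Theory Num.Theory.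
Import numFieldNormedType.Exports.
Local Open Scope classical_set_scope.
Local Open Scope ring_scope.

(* The coordinates of [q : quaternion R] in the basis 1, i, j, k are
   [q 0 0], [q 0 1], [q 0 2%:R], [q 0 3%:R].  The real vector space structure
   and the topology are those of R^4.  The norm [`|q|] inherited from
   ['rV[R]_4] is the sup norm; the Euclidean modulus is [qabs] below. *)
Definition quaternion (R : realType) : Type := 'rV[R]_4.
HB.instance Definition _ (R : realType) :=
  NormedModule.copy (quaternion R) 'rV[R]_4.
HB.instance Definition _ (R : realType) :=
  Uniform_isComplete.Build (quaternion R) (@cauchy_cvg 'rV[R]_4).

Section QuaternionAlgebra.
Context {R : realType}.
Implicit Types p q r : quaternion R.

Definition quat (a b c d : R) : quaternion R :=
  \row_(i < 4) nth 0 [:: a; b; c; d] i.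

Lemma quatP p q :
  p 0 0 = q 0 0 -> p 0 1 = q 0 1 -> p 0 2%:R = q 0 2%:R ->
  p 0 3%:R = q 0 3%:R -> p = q.
Proof.
move=> h0 h1 h2 h3; apply/rowP => i.
by case: i => [[|[|[|[|//]]]] hi]; [move: h0|move: h1|move: h2|move: h3];
  congr (_ = _); congr fun_of_matrix; exact: val_inj.
Qed.

Lemma quatE a b c d :
  (quat a b c d 0 0 = a) * (quat a b c d 0 1 = b) *
  (quat a b c d 0 2%:R = c) * (quat a b c d 0 3%:R = d).
Proof. by do !split; rewrite /quat mxE. Qed.

Definition qone : quaternion R := quat 1 0 0 0.

Definition qmul p q : quaternion R :=
  let p0 := p 0 0 in let p1 := p 0 1 in
  let p2 := p 0 2%:R in let p3 := p 0 3%:R in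
  let q0 := q 0 0 in let q1 := q 0 1 in
  let q2 := q 0 2%:R in let q3 := q 0 3%:R in
  quat (p0 * q0 - p1 * q1 - p2 * q2 - p3 * q3)
       (p0 * q1 + p1 * q0 + p2 * q3 - p3 * q2)
       (p0 * q2 - p1 * q3 + p2 * q0 + p3 * q1)
       (p0 * q3 + p1 * q2 - p2 * q1 + p3 * q0).

Lemma qmulA : associative qmul.
Proof. by move=> p q r; apply: quatP; cbv zeta beta delta [qmul]; rewrite !quatE; ring. Qed.

Lemma qmul1 : left_id qone qmul.
Proof. by move=> p; apply: quatP; rewrite /qmul /qone /= !quatE; ring. Qed.

Lemma qmulr1 : right_id qone qmul.
Proof. by move=> p; apply: quatP; rewrite /qmul /qone /= !quatE; ring. Qed.

Lemma qmulDl : left_distributive qmul +%R.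
Proof. by move=> p q r; apply: quatP; rewrite /qmul /= !quatE !mxE /=; ring. Qed.

Lemma qmulDr : right_distributive qmul +%R.
Proof. by move=> p q r; apply: quatP; rewrite /qmul /= !quatE !mxE /=; ring. Qed.

Lemma qscalerAl (a : R) p q : a *: qmul p q = qmul (a *: p) q.
Proof. by apply: quatP; rewrite mxE /qmul /= !quatE !mxE; ring. Qed.

Lemma qscalerAr (a : R) p q : a *: qmul p q = qmul p (a *: q).
Proof. by apply: quatP; rewrite mxE /qmul /= !quatE !mxE; ring. Qed.

Lemma qone_neq0 : qone != 0.
Proof.
apply/eqP => /(congr1 (fun p : quaternion R => p 0 0)).
by rewrite /qone quatE mxE; apply/eqP; exact: oner_neq0.
Qed.

End QuaternionAlgebra.

HB.instance Definition _ (R : realType) :=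
  GRing.Zmodule_isNzRing.Build (quaternion R)
    (@qmulA R) (@qmul1 R) (@qmulr1 R) (@qmulDl R) (@qmulDr R) (@qone_neq0 R).

HB.instance Definition _ (R : realType) :=
  GRing.Lmodule_isLalgebra.Build R (quaternion R) (@qscalerAl R).

HB.instance Definition _ (R : realType) :=
  GRing.Lalgebra_isAlgebra.Build R (quaternion R) (@qscalerAr R).

Section QuaternionicAnalysis.
Context {R : realType}.
Local Notation H := (quaternion R).

Definition qconj (q : H) : H :=
  quat (q 0 0) (- q 0 1) (- q 0 2%:R) (- q 0 3%:R).

Definition qabs (q : H) : R := Num.sqrt (\sum_(i < 4) q 0 i ^+ 2).

Definition imag_units : set H := [set I | I ^+ 2 = -1].

Definition slice_pt (I : H) (z : R * R) : H := z.1%:A + I * z.2%:A.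

Definition qexp (q : H) : H := limn (series (fun k => (k`!%:R)^-1 *: q ^+ k)).

Section Integral.
Context d (T : measurableType d) (mu : {measure set T -> \bar R}).

Definition qintegrable (f : T -> H) : Prop :=
  forall i, mu.-integrable setT (fun x => (f x 0 i)%:E).

Definition qintegral (f : T -> H) : H :=
  \row_(i < 4) (\int[mu]_x f x 0 i)%R.

End Integral.

Definition slice_hyperholomorphic : set (H -> H) :=
  [set f : H -> H | (forall q, differentiable f q) /\
    forall I, imag_units I -> forall x y : R,
      derive1 (fun t => f (slice_pt I (t, y))) x +
      I * derive1 (fun t => f (slice_pt I (x, t))) y = 0].

(* Planar Lebesgue measure; it represents lambda_I through [slice_pt I]. *)
Definition lebesgue2 := ((@lebesgue_measure R) \x (@lebesgue_measure R))%E.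

(* Density of mu_I with respect to lambda_I. *)
Definition gauss_weight (p : H) : R := pi^-1 * expR (- qabs p ^+ 2).

(* The integral condition does not depend on I. *)
Definition slice_fock : set (H -> H) :=
  [set f : H -> H | slice_hyperholomorphic f /\
    forall I, imag_units I ->
      (\int[lebesgue2]_z
         (gauss_weight (slice_pt I z) * qabs (f (slice_pt I z)) ^+ 2)%:E
       < +oo)%E].

Definition L2H : set (R -> H) :=
  [set phi : R -> H |
    (forall i, measurable_fun setT (fun x => phi x 0 i)) /\
    (\int[lebesgue_measure]_x (qabs (phi x) ^+ 2)%:E < +oo)%E].

Definition bargmann_kernel (q : H) (x : R) : H :=
  (pi `^ (- 4^-1)) *:
  qexp (- (2^-1 *: (q ^+ 2 + (x ^+ 2)%:A)) + (Num.sqrt 2 * x) *: q).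

Definition bargmann (phi : R -> H) (q : H) : H :=
  qintegral lebesgue_measure (fun x => bargmann_kernel q x * phi x).

Definition basis_vec (i : 'I_4) : H := delta_mx 0 i.

Definition has_laplacian (f : H -> H) : Prop :=
  forall (i : 'I_4) q, derivable f q (basis_vec i) /\
    derivable ('D_(basis_vec i) f) q (basis_vec i).

Definition laplacian (f : H -> H) (q : H) : H :=
  \sum_(i < 4) 'D_(basis_vec i) ('D_(basis_vec i) f) q.

Definition fueter : (H -> H) -> (H -> H) := laplacian.

Definition fueter_range : set (H -> H) := fueter @` slice_fock.

Definition fock_kernel (q p : H) : H :=
  limn (series (fun k => (k`!%:R)^-1 *: (q ^+ k * qconj p ^+ k))).

Definition fock_fueter_kernel (q p : H) : H :=
  laplacian (fun q' => fock_kernel q' p) q.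

Definition fock_fueter_integrand (I : H) (f : H -> H) (q : H) (z : R * R) : H :=
  let p := slice_pt I z in
  gauss_weight p *: (fock_fueter_kernel q p * f p).

Definition fock_fueter (I : H) (f : H -> H) (q : H) : H :=
  qintegral lebesgue2 (fock_fueter_integrand I f q).

Definition bargmann_fock_fueter (I : H) (phi : R -> H) : H -> H :=
  fock_fueter I (bargmann phi).

Definition SH : (R -> H) -> (H -> H) := fueter \o id \o bargmann.

Definition Qpoly (k : nat) (q : H) : H :=
  \sum_(0 <= j < k.+1)
    (2 * (k - j + 1)%N%:R / (k.+1%:R * k.+2%:R)) *:
    (q ^+ (k - j)%N * qconj q ^+ j).

Definition hermite (k : nat) (x : R) : R :=
  (-1) ^+ k * expR (x ^+ 2 / 2) * derive1n k (fun t : R => expR (- t ^+ 2)) x.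

Definition Phi_term (q : H) (x : R) (k : nat) : H :=
  (hermite k.+2 x / (2 `^ (k%:R / 2) * k`!%:R)) *: Qpoly k q.

Definition Phi (q : H) (x : R) : H :=
  - ((pi `^ 4^-1)^-1 *: limn (series (Phi_term q x))).

End QuaternionicAnalysis.

(* Main.v *)
(* With H_k the Hermite polynomials, the functions
   e_k(x) = pi^(-1/4) e^(-x^2/2) H_k(x) / (2^(k/2) k!) satisfy
   A(q, x) = sum_k q^k e_k(x) and <e_m, e_k> = delta_mk / k!.  Hence
   B phi (q) = sum_k q^k a_k with a_k = <e_k, phi>, and Bessel's inequality
   gives sum_k k! |a_k|^2 <= ||phi||^2, which is the Fock norm of B phi because
   the monomials are orthogonal for the Gaussian measure on each C_I.
   Since Delta q^(k+2) = - 2 (k+1) (k+2) Q_k(q), applying Delta termwise to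
   A(q, x), to B phi and to the Fock kernel turns the three sides of the
   identity into the same series sum_k Delta(q^k) a_k; the two integrals are
   computed termwise by dominated convergence. *)
Require Import Defs.
From HB Require Import structures.
From mathcomp Require Import all_boot all_order all_algebra.
From mathcomp Require Import all_classical all_reals all_analysis.
From mathcomp Require Import measurable_realfun.
From mathcomp Require Import ring lra.
Set Implicit Arguments.
Unset Strict Implicit.
Unset Printing Implicit Defensive.
Import Order.TTheory GRing.Theory Num.Theory.
Import numFieldNormedType.Exports.
Local Open Scope classical_set_scope.
Local Open Scope ring_scope.

(** * Quaternions *)

Section QuaternionBasics.
Context {R : realType}.
Local Notation H := (quaternion R).
Implicit Types (p q h e : H) (k : nat).

Lemma sum_ord4 (V : nmodType) (F : 'I_4 -> V) :
  \sum_(i < 4) F i = F 0 + F 1 + F 2%:R + F 3%:R.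
Proof.
rewrite !big_ord_recl big_ord0 addr0 !addrA.
by congr (_ + _ + _ + _); congr F; exact: val_inj.
Qed.

Lemma ord4_ind (P : 'I_4 -> Prop) :
  P 0 -> P 1 -> P 2%:R -> P 3%:R -> forall i, P i.
Proof.
move=> h0 h1 h2 h3 [[|[|[|[|//]]]] hi]; [move: h0|move: h1|move: h2|move: h3];
  congr P; exact: val_inj.
Qed.

Lemma coordD p q i : (p + q) 0 i = p 0 i + q 0 i.
Proof. by rewrite mxE. Qed.
Lemma coordN p i : (- p) 0 i = - p 0 i.
Proof. by rewrite mxE. Qed.
Lemma coordZ (a : R) p i : (a *: p) 0 i = a * p 0 i.
Proof. by rewrite mxE. Qed.
Lemma qcoord0 i : (0 : H) 0 i = 0.
Proof. by rewrite mxE. Qed.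
Lemma coord1 : (((1 : H) 0 0 = 1) * ((1 : H) 0 1 = 0) *
  ((1 : H) 0 2%:R = 0) * ((1 : H) 0 3%:R = 0)).
Proof. by do !split; rewrite [1]/(@qone R) /qone quatE. Qed.

Lemma coordM p q :
  ((p * q) 0 0 =
    p 0 0 * q 0 0 - p 0 1 * q 0 1 - p 0 2%:R * q 0 2%:R - p 0 3%:R * q 0 3%:R) *
  ((p * q) 0 1 =
    p 0 0 * q 0 1 + p 0 1 * q 0 0 + p 0 2%:R * q 0 3%:R - p 0 3%:R * q 0 2%:R) *
  ((p * q) 0 2%:R =
    p 0 0 * q 0 2%:R - p 0 1 * q 0 3%:R + p 0 2%:R * q 0 0 + p 0 3%:R * q 0 1) *
  ((p * q) 0 3%:R =
    p 0 0 * q 0 3%:R + p 0 1 * q 0 2%:R - p 0 2%:R * q 0 1 + p 0 3%:R * q 0 0).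
Proof. by rewrite -[p * q]/(qmul p q) /qmul; do !split; rewrite quatE. Qed.

Lemma coordJ p :
  (qconj p 0 0 = p 0 0) * (qconj p 0 1 = - p 0 1) *
  (qconj p 0 2%:R = - p 0 2%:R) * (qconj p 0 3%:R = - p 0 3%:R).
Proof. by rewrite /qconj; do !split; rewrite quatE. Qed.

Lemma coord_sum (I : Type) (s : seq I) (P : pred I) (F : I -> H) i :
  (\sum_(j <- s | P j) F j) 0 i = \sum_(j <- s | P j) F j 0 i.
Proof.
by elim/big_rec2: _ => [|j x y _ <-]; rewrite ?qcoord0 ?coordD.
Qed.

Definition coordE := (coordD, coordN, coordZ, qcoord0, coord1, coordM, coordJ).

Lemma qconjM p q : qconj (p * q) = qconj q * qconj p.
Proof. by apply: quatP; rewrite !coordE; ring. Qed.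

Lemma qconjD p q : qconj (p + q) = qconj p + qconj q.
Proof. by apply: quatP; rewrite !coordE; ring. Qed.

Lemma qconjX p k : qconj (p ^+ k) = qconj p ^+ k.
Proof.
elim: k => [|k IH]; first by rewrite !expr0; apply: quatP; rewrite !coordE ?oppr0.
by rewrite exprS exprSr qconjM IH.
Qed.

Lemma qconj_comm q : q * qconj q = qconj q * q.
Proof. by apply: quatP; rewrite !coordE; ring. Qed.

Lemma qabs_sqr q : qabs q ^+ 2 =
  q 0 0 ^+ 2 + q 0 1 ^+ 2 + q 0 2%:R ^+ 2 + q 0 3%:R ^+ 2.
Proof. by rewrite /qabs sqr_sqrtr ?sum_ord4// !addr_ge0 ?sqr_ge0. Qed.

Lemma qabs_ge0 q : 0 <= qabs q. Proof. exact: sqrtr_ge0. Qed.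

Lemma qabs_sqrE q : qabs q ^+ 2 = (qconj q * q) 0 0.
Proof. by rewrite qabs_sqr !coordE; ring. Qed.

Lemma qabsM p q : qabs (p * q) = qabs p * qabs q.
Proof.
apply/eqP; rewrite -(@eqrXn2 _ 2) ?mulr_ge0 ?qabs_ge0//; apply/eqP.
by rewrite exprMn !qabs_sqr !coordE; ring.
Qed.

Lemma qabs1 : qabs (1 : H) = 1.
Proof.
apply/eqP; rewrite -(@eqrXn2 _ 2) ?qabs_ge0//; apply/eqP.
by rewrite !qabs_sqr !coordE; ring.
Qed.

Lemma qabsJ q : qabs (qconj q) = qabs q.
Proof.
apply/eqP; rewrite -(@eqrXn2 _ 2) ?qabs_ge0//; apply/eqP.
by rewrite !qabs_sqr !coordE; ring.
Qed.

Lemma qabsX q k : qabs (q ^+ k) = qabs q ^+ k.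
Proof. by elim: k => [|k IH]; rewrite ?expr0 ?qabs1// !exprS qabsM IH. Qed.

Lemma coord_le_norm q i : `|q 0 i| <= `|q|.
Proof.
rewrite [leRHS]mx_normrE.
exact: (le_bigmax_cond _ (fun ij : 'I_1 * 'I_4 => `|q ij.1 ij.2|) (j := (0, i))).
Qed.

Lemma norm_le_coord q (C : R) : (forall i, `|q 0 i| <= C) -> `|q| <= C.
Proof.
move=> hC; rewrite [leLHS]mx_normrE; apply/bigmax_leP; split => [|[i j] _ /=].
  exact: le_trans (hC 0).
by rewrite ord1; exact: hC.
Qed.

Lemma coord_le_qabs q i : `|q 0 i| <= qabs q.
Proof.
rewrite -(@ler_pXn2r _ 2) ?nnegrE ?qabs_ge0// real_normK ?num_real//.
rewrite qabs_sqr; elim/ord4_ind: i; have := sqr_ge0 (q 0 0);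
  have := sqr_ge0 (q 0 1); have := sqr_ge0 (q 0 2%:R);
  have := sqr_ge0 (q 0 3%:R); lra.
Qed.

Lemma norm_le_qabs q : `|q| <= qabs q.
Proof. by apply: norm_le_coord => i; exact: coord_le_qabs. Qed.

Lemma qabs_le_norm q : qabs q <= 2 * `|q|.
Proof.
rewrite -(@ler_pXn2r _ 2) ?nnegrE ?qabs_ge0 ?mulr_ge0// qabs_sqr exprMn.
have h i : q 0 i ^+ 2 <= `|q| ^+ 2.
  by rewrite -(@real_normK _ (q 0 i)) ?num_real// lerXn2r ?nnegrE// coord_le_norm.
by have := h 0; have := h 1; have := h 2%:R; have := h 3%:R; lra.
Qed.

Lemma qnormM_le p q : `|p * q| <= 4 * `|p| * `|q|.
Proof.
apply: le_trans (norm_le_qabs _) _; rewrite qabsM.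
apply: le_trans (ler_pM (qabs_ge0 _) (qabs_ge0 _) (qabs_le_norm p) (qabs_le_norm q)) _.
by lra.
Qed.

Lemma qnorm1 : `|(1 : quaternion R)| = 1.
Proof.
apply/eqP; rewrite eq_le; apply/andP; split.
  by apply: le_trans (norm_le_qabs _) _; rewrite qabs1.
by apply: le_trans (coord_le_norm 1 0); rewrite coord1 normr1.
Qed.

Lemma quat_basis q : q = \sum_(i < 4) q 0 i *: basis_vec i.
Proof. by rewrite {1}[q]row_sum_delta. Qed.

End QuaternionBasics.

(** * Normally convergent series *)

Section NormalSeries.
Context {R : realType}.

Lemma is_diff_quadratic (V W : normedModType R) (f : V -> W)
    (df : {linear V -> W}) (x : V) (C : R) :
  (forall h, `|df h| <= C * `|h|) ->
  (forall h, `|h| <= 1 -> `|f (x + h) - f x - df h| <= C * `|h| ^+ 2) ->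
  is_diff x f df.
Proof.
move=> dfC fC.
have dfc : continuous df.
  apply: bounded_linear_continuous; apply/linear_boundedP.
  exists C; split; first exact: num_real.
  move=> r Cr y; apply: le_trans (dfC y) _.
  by apply: ler_wpM2r => //; exact: ltW.
have H : f \o shift x = cst (f x) + df +o_ 0 id.
  apply/eqaddoP => e e0; near=> h.
  have h1 : `|h| <= 1.
    by near: h; apply: nbhs0_le; exact: ltr01.
  have he : `|C| * `|h| <= e.
    have C1 : 0 < `|C| + 1 by rewrite ltr_wpDl.
    have : `|h| <= e / (`|C| + 1).
      by near: h; apply: nbhs0_le; rewrite divr_gt0// ltr_wpDl.
    by rewrite ler_pdivlMr//; have := normr_ge0 h; lra.
  have -> : (f \o shift x - (cst (f x) + df)) h = f (x + h) - f x - df h.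
    by rewrite !fctE /= addrC [h + x]addrC opprD addrC addrA.
  apply: le_trans (fC h h1) _.
  rewrite expr2 mulrA; apply: ler_wpM2r => //=.
  by apply: le_trans he; apply: ler_wpM2r => //; exact: ler_norm.
have E := diff_unique dfc H.
split => //.
by apply/diff_locallyP; split; rewrite E.
Unshelve. all: by end_near. Qed.

Section SeriesLimits.
Variable W : normedModType R.
Implicit Types (u v : nat -> W) (a b : W).

Lemma cvg_seriesD u v a b : series u @ \oo --> a -> series v @ \oo --> b ->
  series (fun k => u k + v k) @ \oo --> a + b.
Proof.
move=> ua vb; have -> : series (fun k => u k + v k) = series u + series v.
  by apply/funext => n; rewrite /series /= big_split.
exact: cvgD.
Qed.

Lemma cvg_seriesZ (c : R) u a : series u @ \oo --> a ->
  series (fun k => c *: u k) @ \oo --> c *: a.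
Proof.
move=> ua; have -> : series (fun k => c *: u k) = c *: series u.
  by apply/funext => n; rewrite /series /= -scaler_sumr.
exact: cvgZl_tmp.
Qed.

Lemma cvg_seriesB u v a b : series u @ \oo --> a -> series v @ \oo --> b ->
  series (fun k => u k - v k) @ \oo --> a - b.
Proof.
move=> ua vb; have -> : series (fun k => u k - v k) = series u - series v.
  by apply/funext => n; rewrite /series /= sumrB.
exact: cvgB.
Qed.

End SeriesLimits.

Lemma normed_series_le (W : completeNormedModType R) (u : nat -> W)
    (M : nat -> R) : (forall k, `|u k| <= M k) -> cvgn (series M) ->
  cvgn (series u) /\ `|limn (series u)| <= limn (series M).
Proof.
move=> uM cM; have cn : cvgn [normed series u].
  apply: (series_le_cvg _ _ uM cM) => k; first exact: normr_ge0.
  exact: le_trans (normr_ge0 _) (uM k).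
split; first exact: normed_cvg.
apply: le_trans (lim_series_norm cn) _.
exact: lim_series_le.
Qed.

Lemma is_diff_series (V : normedModType R) (W : completeNormedModType R)
    (f l : nat -> V -> W) (x : V) (M : nat -> R) :
  (forall k, linear (l k)) -> cvgn (series M) ->
  (forall k h, `|l k h| <= M k * `|h|) ->
  (forall k h, `|h| <= 1 -> `|f k (x + h) - f k x - l k h| <= M k * `|h| ^+ 2) ->
  (forall y, cvgn (series (fun k => f k y))) ->
  is_diff x (fun y => limn (series (fun k => f k y)))
    (fun h => limn (series (fun k => l k h))).
Proof.
move=> ll cM lM fM cf.
have cMr (c : R) : series (fun k => M k * c) @ \oo --> limn (series M) * c.
  rewrite [X in _ --> X]mulrC (_ : (fun _ => _) = (fun k => c *: M k)).
    exact: cvg_seriesZ.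
  by apply/funext => k; rewrite mulrC.
have lc h : cvgn (series (fun k => l k h)) /\
    `|limn (series (fun k => l k h))| <= limn (series M) * `|h|.
  have [|c le] := normed_series_le (lM^~ h).
    by apply: cvgP; exact: cMr.
  by split=> //; apply: le_trans le _; rewrite (cvg_lim _ (cMr _)).
pose L h := limn (series (fun k => l k h)).
have Llin : linear L.
  move=> a u v; apply: cvg_lim => //.
  have -> : (fun k => l k (a *: u + v)) = (fun k => a *: l k u + l k v).
    by apply/funext => k; rewrite ll.
  by apply: cvg_seriesD; [apply: cvg_seriesZ; exact: (lc u).1|exact: (lc v).1].
pose dL : {linear V -> W} := HB.pack L (GRing.isLinear.Build _ _ _ _ L Llin).
apply: (@is_diff_quadratic _ _ _ dL x (limn (series M))) => [h|h h1].
  exact: (lc h).2.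
have [|c le] := normed_series_le (fun k => fM k h h1).
  by apply: cvgP; exact: cMr.
rewrite (cvg_lim _ (cMr _))// in le.
apply: le_trans le; rewrite le_eqVlt; apply/orP; left; apply/eqP; congr `|_|.
apply/esym/cvg_lim => //.
apply: cvg_seriesB; last exact: (lc h).1.
by apply: cvg_seriesB; exact: cf.
Qed.

End NormalSeries.

Section EntireSeries.
Context {R : realType}.
Local Notation H := (quaternion R).
Implicit Types (p q h e : H) (k : nat).

Definition entire (a : nat -> H) :=
  forall r : R, 0 <= r -> exists C : R, forall k, r ^+ k * `|a k| <= C.

Lemma entire_cvg (a : nat -> H) (r C : R) : entire a -> 0 <= r ->
  cvgn (series (fun k => C * r ^+ k * `|a k|)).
Proof.
move=> ea r0.
have -> : (fun k => C * r ^+ k * `|a k|) = C *: (fun k => r ^+ k * `|a k|).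
  by apply/funext => k; rewrite fctE -mulrA.
apply: is_cvg_seriesZ.
have [D DC] := ea (2 * r) (mulr_ge0 (ler0n _ _) r0).
have D0 : 0 <= D by apply: le_trans (DC 0%N); rewrite mulr_ge0 ?exprn_ge0 ?mulr_ge0.
apply: (@series_le_cvg _ _ (geometric D (2^-1))) => [k|k|k|].
- by rewrite mulr_ge0 ?exprn_ge0.
- by rewrite /= mulr_ge0 ?exprn_ge0 ?invr_ge0.
- rewrite /= exprVn ler_pdivlMr ?exprn_gt0//.
  by apply: le_trans (DC k); rewrite exprMn mulrC mulrA.
- by apply: is_cvg_geometric_series; rewrite ger0_norm; lra.
Qed.

(* [dpow k q h] and [d2pow k q e h] are the first and second differentials of
   the [k]-th power map at [q]. *)
Fixpoint dpow k q h : H :=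
  if k is k'.+1 then dpow k' q h * q + q ^+ k' * h else 0.

Fixpoint d2pow k q e h : H :=
  if k is k'.+1 then d2pow k' q e h * q + dpow k' q e * h + dpow k' q h * e
  else 0.

Lemma dpow_linear k q : linear (dpow k q).
Proof.
elim: k => [|k IH] a u v /=; first by rewrite scaler0 addr0.
by rewrite IH; apply: quatP; rewrite !coordE; ring.
Qed.

Lemma d2pow_linear k q e : linear (d2pow k q e).
Proof.
elim: k => [|k IH] a u v /=; first by rewrite scaler0 addr0.
by rewrite IH dpow_linear; apply: quatP; rewrite !coordE; ring.
Qed.

Section Bounds.
Variables (q : H) (r : R).
Hypothesis qr : `|q| + 1 <= r.
Let B := 16 * r.

Let r1 : 1 <= r. Proof. by apply: le_trans qr; rewrite lerDr. Qed.
Let BX_ge0 k : 0 <= B ^+ k.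
Proof. by rewrite exprn_ge0// /B; have := r1; lra. Qed.

Lemma qnormM_le2 p h (a b : R) : `|p| <= a -> `|h| <= b -> `|p * h| <= 4 * a * b.
Proof.
move=> pa hb; apply: le_trans (qnormM_le _ _) _; rewrite -!mulrA ler_wpM2l//.
exact: ler_pM.
Qed.

Let norm_add3 (x y z : H) : `|x + y + z| <= `|x| + `|y| + `|z|.
Proof. by apply: le_trans (ler_normD _ _) _; rewrite lerD2r ler_normD. Qed.

Let scale_ge (x : R) : 0 <= x -> 12 * x <= 12 * r * x.
Proof.
by move=> x0; have : 0 <= (r - 1) * x; [rewrite mulr_ge0// subr_ge0 | lra].
Qed.

Let BS k : B ^+ k.+1 = 16 * r * B ^+ k. Proof. by rewrite exprS. Qed.

Let shift_le h : `|h| <= 1 -> `|q + h| <= r.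
Proof.
by move=> h1; apply: le_trans (ler_normD _ _) _; apply: le_trans qr; rewrite lerD2l.
Qed.

Let q_le : `|q| <= r. Proof. by apply: le_trans qr; rewrite lerDl. Qed.

Lemma norm_pow_le k h : `|h| <= 1 -> `|(q + h) ^+ k| <= B ^+ k.
Proof.
move=> h1; elim: k => [|k IH]; first by rewrite !expr0 qnorm1.
rewrite !exprSr; apply: le_trans (qnormM_le2 IH (shift_le h1)) _.
by rewrite /B; have := scale_ge (BX_ge0 k); have := BX_ge0 k; rewrite /B; lra.
Qed.

Let norm_pow0_le k : `|q ^+ k| <= B ^+ k.
Proof. by rewrite -[q]addr0 norm_pow_le// normr0. Qed.

Lemma norm_dpow_le k h : `|dpow k q h| <= B ^+ k * `|h|.
Proof.
elim: k => [|k IH] /=; first by rewrite normr0 mulr_ge0.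
apply: le_trans (ler_normD _ _) _.
have X1 := qnormM_le2 IH q_le.
have X2 := qnormM_le2 (norm_pow0_le k) (lexx `|h|).
have h0 : 0 <= B ^+ k * `|h| by rewrite mulr_ge0.
apply: le_trans (lerD X1 X2) _.
by have := scale_ge h0; rewrite BS; lra.
Qed.

Lemma norm_d2pow_le k e h : `|d2pow k q e h| <= B ^+ k * (`|e| * `|h|).
Proof.
elim: k => [|k IH] /=; first by rewrite normr0 !mulr_ge0.
apply: le_trans (norm_add3 _ _ _) _.
have X1 := qnormM_le2 IH q_le.
have X2 := qnormM_le2 (norm_dpow_le k e) (lexx `|h|).
have X3 := qnormM_le2 (norm_dpow_le k h) (lexx `|e|).
have h0 : 0 <= B ^+ k * (`|e| * `|h|) by rewrite !mulr_ge0.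
apply: le_trans (lerD (lerD X1 X2) X3) _.
by have := scale_ge h0; rewrite BS; lra.
Qed.

Lemma norm_pow_taylor_le k h : `|h| <= 1 ->
  `|(q + h) ^+ k - q ^+ k - dpow k q h| <= B ^+ k * `|h| ^+ 2.
Proof.
move=> h1; elim: k => [|k IH] /=.
  by rewrite subrr subr0 normr0 !mulr_ge0.
have -> : (q + h) ^+ k.+1 - q ^+ k.+1 - (dpow k q h * q + q ^+ k * h) =
    ((q + h) ^+ k - q ^+ k - dpow k q h) * (q + h) + dpow k q h * h.
  by rewrite !exprSr; apply: quatP; rewrite !coordE; ring.
apply: le_trans (ler_normD _ _) _.
have X1 := qnormM_le2 IH (shift_le h1).
have X2 := qnormM_le2 (norm_dpow_le k h) (lexx `|h|).
have h0 : 0 <= B ^+ k * `|h| ^+ 2 by rewrite !mulr_ge0.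
apply: le_trans (lerD X1 X2) _.
by have := scale_ge h0; rewrite BS; lra.
Qed.

Lemma norm_dpow_taylor_le k e h : `|h| <= 1 ->
  `|dpow k (q + h) e - dpow k q e - d2pow k q e h| <=
  B ^+ k * (`|e| * `|h| ^+ 2).
Proof.
move=> h1; elim: k => [|k IH] /=.
  by rewrite !subr0 normr0 !mulr_ge0.
have -> : dpow k (q + h) e * (q + h) + (q + h) ^+ k * e -
    (dpow k q e * q + q ^+ k * e) -
    (d2pow k q e h * q + dpow k q e * h + dpow k q h * e) =
    (dpow k (q + h) e - dpow k q e - d2pow k q e h) * (q + h) +
    d2pow k q e h * h + ((q + h) ^+ k - q ^+ k - dpow k q h) * e.
  by apply: quatP; rewrite !coordE; ring.
apply: le_trans (norm_add3 _ _ _) _.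
have X1 := qnormM_le2 IH (shift_le h1).
have X2 := qnormM_le2 (norm_d2pow_le k e h) (lexx `|h|).
have X3 := qnormM_le2 (norm_pow_taylor_le k h1) (lexx `|e|).
have h0 : 0 <= B ^+ k * (`|e| * `|h| ^+ 2) by rewrite !mulr_ge0.
apply: le_trans (lerD (lerD X1 X2) X3) _.
by have := scale_ge h0; rewrite BS; lra.
Qed.

End Bounds.
End EntireSeries.

(** * Quaternionic power series *)

Section PowerSeries.
Context {R : realType}.
Local Notation H := (quaternion R).
Implicit Types (p q h e : H) (k : nat) (a : nat -> H).

Lemma le_of_eq (x y : R) : x = y -> x <= y. Proof. by move=> ->. Qed.

Definition pser a q : H := limn (series (fun k => q ^+ k * a k)).

Lemma entire_mul_cvg a (u : nat -> H) (C B : R) : entire a -> 0 <= B ->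
  (forall k, `|u k| <= C * B ^+ k) -> cvgn (series (fun k => u k * a k)).
Proof.
move=> ea B0 uB.
apply: (normed_series_le _ (entire_cvg (C := 4 * C) ea B0)).1 => k.
by apply: le_trans (qnormM_le2 (uB k) (lexx _)) _; rewrite !mulrA.
Qed.

Lemma pser_cvg a q : entire a -> cvgn (series (fun k => q ^+ k * a k)).
Proof.
move=> ea; apply: (@entire_mul_cvg _ _ 1 (16 * (`|q| + 1))) => // k.
rewrite mul1r -[X in X ^+ k]addr0; apply: norm_pow_le => //.
by rewrite normr0.
Qed.

Lemma pser0 a : pser a 0 = a 0%N.
Proof.
apply: cvg_lim => //; rewrite -cvg_shiftS.
have -> : (fun n => series (fun k => (0 : H) ^+ k * a k) n.+1) = cst (a 0%N).
  apply/funext => n; rewrite /series /= big_nat_recl//= expr0 mul1r.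
  by rewrite big1 ?addr0// => k _; rewrite exprS !mul0r.
exact: cvg_cst.
Qed.

Lemma dpow_cvg a q h : entire a -> cvgn (series (fun k => dpow k q h * a k)).
Proof.
move=> ea; apply: (@entire_mul_cvg _ _ `|h| (16 * (`|q| + 1))) => // k.
by rewrite mulrC; exact: norm_dpow_le.
Qed.

Lemma d2pow_cvg a q e h : entire a ->
  cvgn (series (fun k => d2pow k q e h * a k)).
Proof.
move=> ea; apply: (@entire_mul_cvg _ _ (`|e| * `|h|) (16 * (`|q| + 1))) => // k.
by rewrite mulrC; exact: norm_d2pow_le.
Qed.

Lemma pser_is_diff a q : entire a ->
  is_diff q (pser a) (fun h => limn (series (fun k => dpow k q h * a k))).
Proof.
move=> ea; have B0 : 0 <= 16 * (`|q| + 1) by rewrite mulr_ge0// addr_ge0.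
apply: (@is_diff_series R H H (fun k y => y ^+ k * a k)
  (fun k h => dpow k q h * a k) q
  (fun k => 4 * (16 * (`|q| + 1)) ^+ k * `|a k|)).
- by move=> k c u v; rewrite dpow_linear mulrDl -scalerAl.
- exact: entire_cvg.
- move=> k h; apply: le_trans (qnormM_le2 (norm_dpow_le (lexx _) k h) (lexx _)) _.
  by apply: le_of_eq; ring.
- move=> k h h1; rewrite -!mulrBl.
  apply: le_trans (qnormM_le2 (norm_pow_taylor_le (lexx _) k h1) (lexx _)) _.
  by apply: le_of_eq; ring.
- by move=> y; exact: pser_cvg.
Qed.

Lemma pser_derive a q e : entire a ->
  'D_e (pser a) q = limn (series (fun k => dpow k q e * a k)).
Proof.
move=> ea; have [df dv] := pser_is_diff q ea.
by rewrite deriveE// dv.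
Qed.

Lemma pser_derive2 a q e h : entire a ->
  derivable ('D_e (pser a)) q h /\
  'D_h ('D_e (pser a)) q = limn (series (fun k => d2pow k q e h * a k)).
Proof.
move=> ea; have B0 : 0 <= 16 * (`|q| + 1) by rewrite mulr_ge0// addr_ge0.
have -> : 'D_e (pser a) = fun y => limn (series (fun k => dpow k y e * a k)).
  by apply/funext => y; exact: pser_derive.
have [|||||df dv] := @is_diff_series R H H (fun k y => dpow k y e * a k)
  (fun k h => d2pow k q e h * a k) q
  (fun k => (4 * `|e|) * (16 * (`|q| + 1)) ^+ k * `|a k|).
- by move=> k c u v; rewrite d2pow_linear mulrDl -scalerAl.
- exact: entire_cvg.
- move=> k v; apply: le_trans (qnormM_le2 (norm_d2pow_le (lexx _) k e v) (lexx _)) _.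
  by apply: le_of_eq; ring.
- move=> k v v1; rewrite -!mulrBl.
  apply: le_trans (qnormM_le2 (norm_dpow_taylor_le (lexx _) k e v1) (lexx _)) _.
  by apply: le_of_eq; ring.
- by move=> y; exact: dpow_cvg.
by split; [exact: diff_derivable|rewrite deriveE// dv].
Qed.

Definition lap k q : H := \sum_(i < 4) d2pow k q (basis_vec i) (basis_vec i).

Lemma norm_basis_vec i : `|basis_vec i : H| <= 1.
Proof.
apply: norm_le_coord => j; rewrite mxE /=.
by case: eqP => _; rewrite ?normr1 ?normr0.
Qed.

Lemma norm_lap_le k q : `|lap k q| <= 4 * (16 * (`|q| + 1)) ^+ k.
Proof.
have B0 : 0 <= 16 * (`|q| + 1) by rewrite mulr_ge0// addr_ge0.
have le i : `|d2pow k q (basis_vec i) (basis_vec i)| <= (16 * (`|q| + 1)) ^+ k.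
  apply: le_trans (norm_d2pow_le (lexx _) k _ _) _.
  rewrite -[leRHS]mulr1; rewrite ler_wpM2l ?exprn_ge0// -[leRHS]mulr1.
  by apply: ler_pM => //; exact: norm_basis_vec.
apply: le_trans (ler_norm_sum _ _ _) _.
apply: le_trans (ler_sum _ (fun i _ => le i)) _.
by rewrite sumr_const card_ord [leRHS]mulr_natl; exact: lexx.
Qed.

Lemma lap_cvg a q : entire a -> cvgn (series (fun k => lap k q * a k)).
Proof.
move=> ea; apply: (@entire_mul_cvg _ _ 4 (16 * (`|q| + 1))) => // k.
exact: norm_lap_le.
Qed.

Lemma pser_has_laplacian a : entire a -> has_laplacian (pser a).
Proof.
move=> ea i q; split; last exact: (pser_derive2 _ _ _ ea).1.
by apply: diff_derivable; have [] := pser_is_diff q ea.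
Qed.

Lemma pser_laplacian a q : entire a ->
  laplacian (pser a) q = limn (series (fun k => lap k q * a k)).
Proof.
move=> ea; apply/esym/cvg_lim => //; rewrite /laplacian.
have -> : series (fun k => lap k q * a k) = fun n =>
    \sum_(i < 4) series (fun k => d2pow k q (basis_vec i) (basis_vec i) * a k) n.
  apply/funext => n; rewrite /series /= exchange_big /=.
  by apply: eq_bigr => k _; rewrite /lap mulr_suml.
apply: cvg_big => [|i _].
  exact: add_continuous.
rewrite (pser_derive2 q _ _ ea).2.
exact: d2pow_cvg.
Qed.

End PowerSeries.

Section LaplacianPowers.
Context {R : realType}.
Local Notation H := (quaternion R).
Implicit Types (p q h e : H) (k : nat).

Lemma basis_vecE i j : (basis_vec i : H) 0 j = (j == i)%:R.
Proof. by rewrite mxE eqxx. Qed.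

Lemma sum_basis_sandwich p :
  \sum_(i < 4) basis_vec i * p * basis_vec i = - 2 *: qconj p.
Proof.
by rewrite sum_ord4; apply: quatP; rewrite !coordE !basis_vecE /=; ring.
Qed.

Lemma dpowSl k q h : dpow k.+1 q h = q * dpow k q h + h * q ^+ k.
Proof.
elim: k => [|k IH] /=; first by rewrite mul0r mulr0 !expr0 mul1r mulr1.
rewrite [X in X * q](IH : dpow k q h * q + q ^+ k * h = _).
rewrite [X in X * h]exprS [in RHS]exprSr.
by rewrite mulrDr mulrDl !mulrA addrAC.
Qed.

Lemma sum_dpow_basis k q :
  \sum_(i < 4) dpow k.+1 q (basis_vec i) * basis_vec i =
  - 2 *: \sum_(0 <= j < k.+1) q ^+ (k - j) * qconj q ^+ j.
Proof.
elim: k => [|k IH].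
  under eq_bigr do rewrite dpowSl /= mulr0 add0r expr0 mulr1 -[X in X * _]mulr1.
  rewrite sum_basis_sandwich big_nat1 subnn expr0 mulr1; congr (_ *: _).
  by apply: quatP; rewrite !coordE ?oppr0.
under eq_bigr do rewrite dpowSl mulrDl -mulrA.
rewrite big_split /= -mulr_sumr IH sum_basis_sandwich.
rewrite [in RHS]big_nat_recr //= subnn expr0 mul1r scalerDr -scalerAr qconjX.
congr (_ *: _ + _); rewrite mulr_sumr; apply: eq_big_nat => j /andP[_ jk].
by rewrite subSn// exprS mulrA.
Qed.

Lemma lap0 q : lap 0 q = 0.
Proof. by rewrite /lap big1. Qed.

Lemma lap1 q : lap 1 q = 0.
Proof. by rewrite /lap big1// => i _ /=; rewrite !mul0r !addr0. Qed.

Lemma lapS k q : lap k.+1 q =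
  lap k q * q + 2 *: \sum_(i < 4) dpow k q (basis_vec i) * basis_vec i.
Proof.
rewrite /lap /= !big_split /= -mulr_suml -addrA; congr (_ + _).
by rewrite scaler_nat mulr2n.
Qed.

Lemma lapSS k q : lap k.+2 q =
  - 4 *: \sum_(0 <= j < k.+1) (k - j).+1%:R *: (q ^+ (k - j) * qconj q ^+ j).
Proof.
elim: k => [|k IH].
  rewrite lapS lap1 mul0r add0r sum_dpow_basis scalerA !big_nat1 scale1r.
  by congr (_ *: _); ring.
rewrite lapS IH sum_dpow_basis scalerA -scalerAl mulr_suml.
rewrite [X in _ + X *: _](_ : _ = - 4); last by ring.
rewrite -scalerDr; congr (_ *: _).
rewrite [X in _ + X]big_nat_recr //= addrA -big_split /= [RHS]big_nat_recr //= subnn scale1r.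
congr (_ + _); apply: eq_big_nat => j /andP[_ jk].
rewrite subSn// -[in RHS]addn1 natrD scalerDl scale1r; congr (_ + _).
rewrite -scalerAl; congr (_ *: _); rewrite exprSr -!mulrA; congr (_ * _).
by apply/esym; apply: commrX; exact: qconj_comm.
Qed.

Lemma lap_Qpoly k q :
  lap k.+2 q = - (2 * (k.+1%:R * k.+2%:R)) *: Qpoly k q.
Proof.
rewrite lapSS /Qpoly !scaler_sumr; apply: eq_big_nat => j jk.
rewrite !scalerA; congr (_ *: _); rewrite addn1.
have := pnatr_eq0 R k.+1; have := pnatr_eq0 R k.+2.
move: (k.+1%:R) (k.+2%:R) => x y /negbT y0 /negbT x0.
by field; rewrite x0 y0.
Qed.

End LaplacianPowers.

Section QuaternionLimits.
Context {R : realType}.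
Local Notation H := (quaternion R).
Implicit Types (p q : H) (k : nat).

Lemma cvg_coord {T : Type} (F : set_system T) {FF : Filter F} (u : T -> H) (l : H) i :
  u @ F --> l -> (fun t => u t 0 i) @ F --> (l 0 i : R).
Proof. by move=> ul; exact: (cvg_comp _ _ ul (@coord_continuous R 1 4 0 i l)). Qed.

Lemma cvg_quat {T : Type} (F : set_system T) {FF : Filter F} (u : T -> H) (l : H) :
  (forall i, (fun t => u t 0 i) @ F --> (l 0 i : R)) -> u @ F --> l.
Proof.
move=> ul; rewrite (quat_basis l).
have -> : u = fun t => \sum_(i < 4) u t 0 i *: basis_vec i.
  by apply/funext => t; exact: quat_basis.
apply: cvg_big => [|i _]; first exact: add_continuous.
exact: cvgZr_tmp.
Qed.

Lemma qcvgM {T : Type} (F : set_system T) {FF : Filter F} (u v : T -> H) (a b : H) :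
  u @ F --> a -> v @ F --> b -> (fun t => u t * v t) @ F --> a * b.
Proof.
move=> ua vb; apply: cvg_quat => i.
have cu j := cvg_coord (i := j) ua; have cv j := cvg_coord (i := j) vb.
by elim/ord4_ind: i; rewrite coordM; under eq_fun do rewrite coordM;
  repeat first [apply: cvgM; [exact: cu|exact: cv] | apply: cvgB | apply: cvgD].
Qed.

Lemma qcvg_seriesMl (u : nat -> H) (p l : H) : series u @ \oo --> l ->
  series (fun k => p * u k) @ \oo --> p * l.
Proof.
move=> ul; have -> : series (fun k => p * u k) = fun n => p * series u n.
  by apply/funext => n; rewrite /series /= mulr_sumr.
by apply: qcvgM => //; exact: cvg_cst.
Qed.

Lemma qcvg_seriesMr (u : nat -> H) (p l : H) : series u @ \oo --> l ->
  series (fun k => u k * p) @ \oo --> l * p.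
Proof.
move=> ul; have -> : series (fun k => u k * p) = fun n => series u n * p.
  by apply/funext => n; rewrite /series /= mulr_suml.
by apply: qcvgM => //; exact: cvg_cst.
Qed.

End QuaternionLimits.

(** * The quaternionic exponential *)

Section QuaternionProduct.
Context {R : realType}.
Local Notation H := (quaternion R).
Implicit Types (p q : H) (k : nat).

Lemma qmul_is_bilinear :
  bilinear_for
    (GRing.Scale.Law.clone _ _ *:%R _) (GRing.Scale.Law.clone _ _ *:%R _)
    (@qmul R).
Proof.
split=> [u'|u] a x y /=.
- by rewrite -[qmul _ _]/((a *: x + y : H) * u') mulrDl -scalerAl.
- by rewrite -[qmul _ _]/((u : H) * (a *: x + y)) mulrDr -scalerAr.
Qed.
HB.instance Definition _ := bilinear_isBilinear.Build R H H H _ _ (@qmul R)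
  qmul_is_bilinear.

Lemma is_diff_qmul (V : normedModType R) (f g df dg : V -> H) (x : V) :
  is_diff x f df -> is_diff x g dg ->
  is_diff x (fun y => f y * g y) (fun t => f x * dg t + df t * g x).
Proof.
move=> dfx dgx.
have mc : continuous (fun t : H * H => t.1 * t.2).
  by move=> p; apply: qcvgM; [exact: cvg_fst|exact: cvg_snd].
have dm : is_diff (f x, g x) (fun t : H * H => t.1 * t.2)
    (fun t => f x * t.2 + t.1 * g x).
  apply: DiffDef; first exact: (@differentiable_bilin _ H H H (@qmul R : {bilinear H -> H -> H}) _ mc).
  exact: (@diff_bilin _ H H H (@qmul R : {bilinear H -> H -> H}) _ mc).
exact: (is_diff_comp (is_diff_pair dfx dgx) dm).
Qed.

Lemma is_diff_coord (V : normedModType R) (f df : V -> H) (x : V) i :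
  is_diff x f df -> is_diff x (fun y => f y 0 i : R) (fun t => df t 0 i).
Proof.
move=> dfx.
have dm : is_diff (f x) (fun p : H => p 0 i : R) (fun p => p 0 i).
  have lin : linear (fun p : H => p 0 i : R^o) by move=> a u v; rewrite !mxE.
  pose dL : {linear H -> R^o} := HB.pack (fun p : H => p 0 i : R^o)
    (GRing.isLinear.Build _ _ _ _ (fun p : H => p 0 i : R^o) lin).
  have dc : continuous dL by exact: coord_continuous.
  by apply: DiffDef; [exact: (@linear_differentiable _ H R^o dL (f x) dc)|exact: (@diff_lin _ H R^o dL _ dc)].
exact: (is_diff_comp (f := f) dfx dm).
Qed.

Lemma is_diff0_cst (f : R -> H) :
  (forall x : R, is_diff x f (fun=> 0)) -> forall x y, f x = f y.
Proof.
move=> df x y; apply/rowP => i; apply: (@is_derive_0_is_cst _ (fun t => f t 0 i)) => t.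
have := is_diff_coord i (df t) => -[dif dv].
apply: DeriveDef; first exact/derivable1_diffP.
by rewrite deriveE// dv mxE.
Qed.

End QuaternionProduct.

Section QuaternionExponential.
Context {R : realType}.
Local Notation H := (quaternion R).
Implicit Types (p q h e v : H) (k : nat).

Definition expc k : H := (k`!%:R^-1 : R)%:A.

Lemma exp_coeff_le (x : R) k : 0 <= x -> x ^+ k / k`!%:R <= expR x.
Proof.
move=> x0; have c0 j : 0 <= exp_coeff x j by rewrite /exp_coeff /= divr_ge0 ?exprn_ge0.
apply: (@le_trans _ _ (series (exp_coeff x) k.+1)).
  by rewrite /series /= big_nat_recr //= lerDr sumr_ge0.
apply: nondecreasing_cvgn_le; last exact: is_cvg_series_exp_coeff.
exact: nondecreasing_series.
Qed.

Lemma entire_scaled_fact a : (exists r C : R, 0 <= r /\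
    forall k, `|a k| <= C * r ^+ k / k`!%:R) -> entire (a : nat -> H).
Proof.
move=> [r [C [r0 aC]]] s s0; exists (`|C| * expR (s * r)) => k.
have sr0 : 0 <= s * r by rewrite mulr_ge0.
apply: (@le_trans _ _ (s ^+ k * (`|C| * r ^+ k / k`!%:R))).
  rewrite ler_wpM2l ?exprn_ge0//; apply: le_trans (aC k) _.
  by rewrite -!mulrA ler_wpM2r ?divr_ge0 ?exprn_ge0// ler_norm.
apply: le_trans (ler_wpM2l (normr_ge0 C) (exp_coeff_le k sr0)).
by rewrite exprMn; apply: le_of_eq; ring.
Qed.

Lemma qnormA (c : R) : `|c%:A : H| = `|c|.
Proof. by rewrite normrZ qnorm1 mulr1. Qed.

Lemma entire_expc : entire expc.
Proof.
apply: entire_scaled_fact; exists 1, 1; split => // k.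
by rewrite /expc qnormA expr1n mul1r mul1r ger0_norm ?invr_ge0.
Qed.

Lemma qexpE q : qexp q = pser expc q.
Proof.
rewrite /qexp /pser; congr (limn (series _)); apply/funext => k.
by rewrite /expc -scalerAr mulr1.
Qed.

Lemma dpow_comm k v e : v * e = e * v -> dpow k.+1 v e = k.+1%:R *: (e * v ^+ k).
Proof.
move=> ve; elim: k => [|k IH]; first by rewrite /= mul0r add0r expr0 scale1r mul1r mulr1.
rewrite -[dpow k.+2 v e]/(dpow k.+1 v e * v + v ^+ k.+1 * e) IH -scalerAl -mulrA -exprSr.
have -> : v ^+ k.+1 * e = e * v ^+ k.+1 by apply/esym/commrX.
by rewrite -[in RHS]natr1 scalerDl scale1r.
Qed.

Lemma qexp_diff v e : v * e = e * v ->
  limn (series (fun k => dpow k v e * expc k)) = e * qexp v.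
Proof.
move=> ve; apply: cvg_lim => //; rewrite qexpE.
rewrite -cvg_shiftS.
have -> : (fun n => series (fun k => dpow k v e * expc k) n.+1) =
    series (fun k => e * (v ^+ k * expc k)).
  apply/funext => n; rewrite /series /= big_nat_recl//= mul0r add0r.
  apply: eq_bigr => k _; rewrite -/(dpow k.+1 v e) dpow_comm// /expc.
  rewrite -!scalerAr !mulr1 scalerA; congr (_ *: _).
  by rewrite factS natrM invfM mulrAC mulVf ?mul1r// pnatr_eq0.
apply: qcvg_seriesMl; exact: pser_cvg entire_expc.
Qed.

Lemma is_diff_qexp_curve (w dw : R -> H) (s : R) :
  is_diff s w dw -> (forall t, w s * dw t = dw t * w s) ->
  is_diff s (fun t => qexp (w t)) (fun t => dw t * qexp (w s)).
Proof.
move=> dws cw.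
have -> : (fun t => qexp (w t)) = pser expc \o w.
  by apply/funext => t /=; rewrite qexpE.
apply: is_diff_eq (is_diff_comp dws (pser_is_diff (w s) entire_expc)) _.
by apply/funext => t /=; rewrite qexp_diff.
Qed.

Lemma qexp_real (r : R) : qexp r%:A = (expR r)%:A.
Proof.
apply: cvg_lim => //.
have -> : series (fun k => (k`!%:R)^-1 *: (r%:A : H) ^+ k) =
    fun n => series (exp_coeff r) n *: (1 : H).
  apply/funext => n; rewrite /series /= scaler_suml; apply: eq_bigr => k _.
  by rewrite /exp_coeff /= exprZn expr1n scalerA mulrC.
exact: cvgZr_tmp (is_cvg_series_exp_coeff r).
Qed.

Lemma is_diff_scale_curve (g : R -> R) (dg : R) v (s : R) :
  is_derive s 1 g dg -> is_diff s (fun t => g t *: v) (fun t => (dg * t) *: v).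
Proof.
move=> [gd gv].
have gs : is_diff s g (fun t => dg * t).
  have gD : differentiable g s by apply/derivable1_diffP.
  apply: DiffDef => //; apply/funext => t.
  have -> : t = t *: 1 :> R by rewrite -[RHS]/(t * 1) mulr1.
  by rewrite linearZ -deriveE// gv /= -[t *: 1]/(t * 1) mulr1 mulrC.
exact: (is_diff_comp gs (is_diff_scalel (g s) v)).
Qed.

Lemma qexp_comm v e : v * e = e * v -> qexp v * e = e * qexp v.
Proof.
move=> ve; rewrite qexpE; have cv := pser_cvg (q := v) entire_expc.
have h1 := qcvg_seriesMr (p := e) cv; have h2 := qcvg_seriesMl (p := e) cv.
rewrite (_ : (fun k => e * _) = (fun k => v ^+ k * expc k * e)) in h2.
  exact: cvg_unique h1 h2.
apply/funext => k; rewrite /expc -!scalerAr -!scalerAl !mulr1.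
by congr (_ *: _); apply: commrX.
Qed.

Lemma qexpN v : qexp v * qexp (- v) = 1.
Proof.
have dw (c s : R) : is_diff s (fun t => (c * t) *: v) (fun t => (c * t) *: v).
  apply: is_diff_scale_curve.
  by apply: is_derive_eq; rewrite -[c *: 1]/(c * 1) mulr1.
pose Y (s : R) := qexp ((1 * s) *: v) * qexp ((-1 * s) *: v).
have dY s : is_diff s Y (fun=> 0).
  have cm (a b : R) : (a *: v) * (b *: v) = (b *: v) * (a *: v).
    by rewrite -!scalerAl -!scalerAr !scalerA mulrC.
  have e c := is_diff_qexp_curve (dw c s) (fun t => cm _ _).
  apply: is_diff_eq (is_diff_qmul (e 1) (e (-1))) _.
  apply/funext => t; rewrite mulrA.
  have vv : ((1 * s) *: v) * v = v * ((1 * s) *: v) by rewrite -scalerAl -scalerAr.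
  rewrite -scalerAr (qexp_comm vv) -!scalerAl -scalerDl.
  by rewrite mul1r mulN1r addNr scale0r.
have := is_diff0_cst dY 1 0; rewrite /Y !mulr1 !mulr0 !scale1r !scaleN1r scale0r => ->.
have q0 : qexp (0 : H) = 1.
  by have := qexp_real 0; rewrite scale0r expR0 scale1r.
by rewrite q0 mulr1.
Qed.


End QuaternionExponential.

(** * Hermite functions and the Bargmann kernel *)

Section Hermite.
Context {R : realType}.
Local Notation H := (quaternion R).
Implicit Types (x r : R) (k : nat).

Let s2 : R := Num.sqrt 2.
Let s2_sqr : s2 ^+ 2 = 2. Proof. by rewrite sqr_sqrtr. Qed.
Let s2_gt0 : 0 < s2. Proof. by rewrite sqrtr_gt0. Qed.

(* [nherm k] is [H_k / (2^(k/2) k!)] with [H_k] the Hermite polynomial, and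
   [nherm_pred k] is [nherm k.-1], or [0] for [k = 0]. *)
Fixpoint nherm2 k x : R * R :=
  if k is k'.+1 then
    ((Num.sqrt 2 * x * (nherm2 k' x).1 - (nherm2 k' x).2) / k'.+1%:R,
     (nherm2 k' x).1)
  else (1, 0).

Definition nherm k x := (nherm2 k x).1.
Definition nherm_pred k x := (nherm2 k x).2.

Lemma nhermS k x :
  k.+1%:R * nherm k.+1 x = s2 * x * nherm k x - nherm_pred k x.
Proof. by rewrite /nherm /nherm_pred /= mulrC divfK// pnatr_eq0. Qed.

Lemma is_derive_nherm k x : is_derive x 1 (nherm k) (s2 * nherm_pred k x).
Proof.
have : is_derive x 1 (nherm k) (s2 * nherm_pred k x) /\
  is_derive x 1 (nherm k.+1) (s2 * nherm k x); last by case.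
elim: k => [|k [IH1 IH2]].
  split; first by rewrite /nherm_pred /= mulr0; exact: is_derive_cst.
  have -> : nherm 1 = (fun x => s2 * x) by apply/funext => y; rewrite /nherm /= subr0 mulr1 divr1.
  by apply: is_derive_eq; rewrite -[s2 *: 1]/(s2 * 1).
split=> //.
have -> : nherm k.+2 = (fun x => k.+2%:R^-1 *: (s2 *: (x * nherm k.+1 x) - nherm k x)).
  apply/funext => y; rewrite -[LHS]/((s2 * y * nherm k.+1 y - nherm k y) / k.+2%:R).
  by rewrite mulrC -mulrA.
apply: is_derive_eq.
rewrite /GRing.scale /= mulr1.
have := nhermS k x.
have : k.+2%:R = k.+1%:R + 1 :> R by rewrite -natr1.
have : k.+1%:R + 1 != 0 :> R by rewrite natr1 pnatr_eq0.
move: (nherm k.+1 x) (nherm k x) (nherm_pred k x) (k.+1%:R) => a b c K K0 -> E.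
have -> : s2 * (x * (s2 * b) + a) - s2 * c = s2 * ((K + 1) * a).
  by rewrite mulrDl E; ring.
by rewrite mulrCA mulKf.
Qed.

Lemma gauss_derive k :
  derive1n k (fun t : R => expR (- t ^+ 2)) =
  (fun x => (-1) ^+ k * (s2 ^+ k * k`!%:R) * (nherm k x * expR (- x ^+ 2))).
Proof.
elim: k => [|k IH].
  by apply/funext => x; rewrite /= /nherm /= !expr0 fact0 !mul1r.
rewrite derive1nS IH; apply/funext => x; rewrite derive1E.
have d1 := is_derive_nherm k x.
apply: derive_val.
apply: is_derive_eq.
rewrite /GRing.scale /= !mulr1 !exprS factS natrM.
have := nhermS k x.
move: (nherm k.+1 x) (nherm k x) (nherm_pred k x) (k.+1%:R) (expR _) => a b c K E e.
transitivity ((-1) ^+ k * s2 ^+ k * k`!%:R * E * (- (s2 * (s2 * x * b - c)))).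
  by rewrite mulrBr !mulrA -expr2 s2_sqr; ring.
by rewrite -e; ring.
Qed.

Lemma hermiteE k x :
  hermite k x = s2 ^+ k * k`!%:R * (nherm k x * expR (- (x ^+ 2 / 2))).
Proof.
rewrite /hermite gauss_derive.
have -> : expR (- x ^+ 2) = expR (- (x ^+ 2 / 2)) ^+ 2.
  by rewrite -expRM_natl; congr expR; field.
have e1 : expR (x ^+ 2 / 2) * expR (- (x ^+ 2 / 2)) = 1 by rewrite expRxMexpNx_1.
have s1 : (-1) ^+ k * (-1) ^+ k = 1 :> R by rewrite -exprMn mulN1r opprK expr1n.
move: (expR (x ^+ 2 / 2)) (expR (- (x ^+ 2 / 2))) e1 => u v uv.
transitivity (((-1) ^+ k * (-1) ^+ k) * (u * v) *
  (s2 ^+ k * k`!%:R * (nherm k x * v))); first by ring.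
by rewrite s1 uv !mul1r.
Qed.

Let exp_sum (b : R) k := \sum_(j < k.+1) b ^+ j / j`!%:R.

Let exp_sum_step (b : R) k : 0 <= b -> b * exp_sum b k <= k.+1%:R * exp_sum b k.+1.
Proof.
move=> b0; rewrite /exp_sum [in leRHS]big_ord_recl /= [leRHS]mulrDr.
apply: (@le_trans _ _ (k.+1%:R * \sum_(i < k.+1) b ^+ i.+1 / i.+1`!%:R)); last first.
  by rewrite lerDr mulr_ge0 ?divr_ge0.
rewrite !mulr_sumr; apply: ler_sum => -[i ik] _ /=.
have -> : b * (b ^+ i / i`!%:R) = i.+1%:R * (b ^+ i.+1 / i.+1`!%:R).
  rewrite factS natrM exprS.
  have : i.+1%:R != 0 :> R by rewrite pnatr_eq0.
  have : i`!%:R != 0 :> R by rewrite pnatr_eq0 -lt0n fact_gt0.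
  move: (i.+1%:R) (i`!%:R) (b ^+ i) => K F B F0 K0.
  by field; rewrite K0 F0.
by rewrite ler_wpM2r ?divr_ge0 ?exprn_ge0// ler_nat.
Qed.

Let exp_sum_mono (b : R) k : 0 <= b -> exp_sum b k <= exp_sum b k.+1.
Proof.
by move=> b0; rewrite /exp_sum [leRHS]big_ord_recr lerDl divr_ge0 ?exprn_ge0.
Qed.

(* By the recursion, [v_k = |nherm k x| r^k] satisfies
   [(k+1) v_(k+1) <= s2 |x| r v_k + r^2 v_(k-1)], hence is dominated by the
   partial sums of the exponential series at [s2 |x| r + r^2]. *)
Lemma nherm_le k x r : 0 <= r ->
  `|nherm k x| * r ^+ k <= expR (s2 * `|x| * r + r ^+ 2).
Proof.
move=> r0; set b := _ + _.
have sxr : 0 <= s2 * `|x| * r by rewrite !mulr_ge0 // ltW.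
have b0 : 0 <= b by rewrite addr_ge0// sqr_ge0.
have : `|nherm k x| * r ^+ k <= exp_sum b k /\
       `|nherm_pred k x| * r ^+ k <= r * exp_sum b k.
  have S0 j : 0 <= exp_sum b j.
    by apply: sumr_ge0 => i _; rewrite divr_ge0 ?exprn_ge0.
  elim: k => [|k [IH1 IH2]].
    rewrite /nherm /nherm_pred /= !expr0 !mulr1 normr0 normr1.
    split; last by rewrite mulr_ge0.
    by rewrite /exp_sum big_ord1 expr0 fact0 divr1.
  split; last first.
    rewrite -/(nherm k x) exprS mulrCA ler_wpM2l//.
    exact: le_trans IH1 (exp_sum_mono _ b0).
  rewrite -(@ler_pM2l _ k.+1%:R) ?ltr0n// mulrA.
  have -> : k.+1%:R * `|nherm k.+1 x| = `|s2 * x * nherm k x - nherm_pred k x|.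
    by rewrite -nhermS (normrM k.+1%:R) normr_nat.
  apply: (@le_trans _ _ (b * exp_sum b k)); last exact: exp_sum_step.
  apply: (@le_trans _ _ ((s2 * `|x| * `|nherm k x| + `|nherm_pred k x|) * r ^+ k.+1)).
    rewrite ler_wpM2r ?exprn_ge0//; apply: le_trans (ler_normB _ _) _.
    by rewrite lerD2r !normrM [`|s2|]gtr0_norm.
  have := ler_wpM2l sxr IH1; have := ler_wpM2l r0 IH2.
  by rewrite exprS /b; lra.
case=> h _; apply: le_trans h _.
have -> : exp_sum b k = series (exp_coeff b) k.+1 by rewrite /series /= big_mkord.
apply: nondecreasing_cvgn_le; last exact: is_cvg_series_exp_coeff.
by apply: nondecreasing_series => n _ _; rewrite /exp_coeff /= divr_ge0 ?exprn_ge0.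
Qed.

Definition nhermf k x : R :=
  pi `^ (- 4^-1) * expR (- (x ^+ 2 / 2)) * nherm k x.

Lemma nhermfS k x : k.+1%:R * nhermf k.+1 x =
  s2 * x * nhermf k x - (if k is k'.+1 then nhermf k' x else 0).
Proof.
rewrite /nhermf mulrCA nhermS mulrBr; congr (_ - _); first by rewrite mulrCA.
by case: k => [|k]; rewrite /nherm_pred //= mulr0.
Qed.

Lemma nhermf_le k x r : 0 <= r -> `|nhermf k x| * r ^+ k <=
  pi `^ (- 4^-1) * expR (- (x ^+ 2 / 2)) * expR (s2 * `|x| * r + r ^+ 2).
Proof.
move=> r0; rewrite /nhermf normrM ger0_norm; last by rewrite mulr_ge0 ?powR_ge0 ?expR_ge0.
by rewrite -[leLHS]mulrA ler_wpM2l ?nherm_le// mulr_ge0 ?powR_ge0 ?expR_ge0.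
Qed.

Lemma entire_nhermf x : entire (fun k => (nhermf k x)%:A : H).
Proof.
move=> r r0; eexists => k; rewrite qnormA mulrC; exact: nhermf_le.
Qed.

Lemma Phi_term_lap (q : H) x k :
  lap k.+2 q * (nhermf k.+2 x)%:A = - (pi `^ (- 4^-1)) *: Phi_term q x k.
Proof.
rewrite lap_Qpoly -scalerAr mulr1 !scalerA; congr (_ *: _).
rewrite hermiteE /nhermf.
have -> : 2 `^ (k%:R / 2) = s2 ^+ k.
  by rewrite mulrC powRrM powR12_sqrt// powR_mulrn// ltW.
rewrite !factS !natrM !exprS.
have : s2 ^+ k != 0 by rewrite expf_neq0// gt_eqF.
have : k`!%:R != 0 :> R by rewrite pnatr_eq0 -lt0n fact_gt0.
move: (s2 ^+ k) (k`!%:R) (k.+1%:R) (k.+2%:R) (nherm _ _) (expR _) (powR _ _).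
move=> a b c d u v w b0 a0.
transitivity (- w * ((s2 ^+ 2) * (d * c) * (u * v))).
  by rewrite s2_sqr; ring.
by field; rewrite a0 b0.
Qed.

Let scale_shuffle (K t N : R) (p Y : H) :
  K *: (t *: p * Y) * N%:A = t *: ((K * N) *: (p * Y)).
Proof. by rewrite -!scalerAl -!scalerAr mulr1 !scalerA; congr (_ *: _); ring. Qed.

Let scale_shuffle1 (t y N : R) (p Y : H) :
  t *: ((y * N) *: (p * Y)) = (t * y) *: p * (Y * N%:A).
Proof. by rewrite -!scalerAl -!scalerAr mulr1 !scalerA; congr (_ *: _); ring. Qed.

Let scale_shuffle2 (t y N M s : R) (p Y : H) :
  t *: ((y * N - M) *: (p * (s *: p * Y))) =
  (t * y) *: p * (s *: p * Y * N%:A) - (t * s) *: p ^+ 2 * (Y * M%:A).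
Proof.
rewrite -?scalerAl -?scalerAr ?mulr1 -?scalerAl -?scalerAr !scalerA !mulrA -expr2.
rewrite -?scalerAl -?scalerAr ?mulr1 -?scalerAl -?scalerAr ?scalerA -scalerBl.
by congr (_ *: _); rewrite -![_ *: _ : R]/(_ * _); ring.
Qed.

Lemma is_diff_nhermf_series (q : H) x (s : R) :
  is_diff s (fun t => pser (fun k => (nhermf k x)%:A) (t *: q))
    (fun t => (t * (s2 * x)) *: q * pser (fun k => (nhermf k x)%:A) (s *: q) -
              (t * s) *: q ^+ 2 * pser (fun k => (nhermf k x)%:A) (s *: q)).
Proof.
have dw : is_diff s (fun t => t *: q) (fun t => (1 * t) *: q).
  exact: is_diff_scale_curve.
apply: is_diff_eq (is_diff_comp dw (pser_is_diff (s *: q) (entire_nhermf x))) _.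
apply/funext => t /=; apply: cvg_lim => //.
have cF := pser_cvg (q := s *: q) (entire_nhermf x).
pose u k : H := (s *: q) ^+ k * (nhermf k x)%:A.
rewrite -cvg_shiftS.
have -> : (fun n => series (fun k => dpow k (s *: q) ((1 * t) *: q) * (nhermf k x)%:A) n.+1) =
  (fun n => (t * (s2 * x)) *: q * series u n -
            (t * s) *: q ^+ 2 * (if n is n'.+1 then series u n' else 0)).
  apply/funext => n; rewrite /series /= big_nat_recl//= mul0r add0r.
  have term k : dpow k.+1 (s *: q) ((1 * t) *: q) * (nhermf k.+1 x)%:A =
      (t * (s2 * x)) *: q * u k -
      (t * s) *: q ^+ 2 * (if k is k'.+1 then u k' else 0).
    rewrite dpow_comm ?mul1r; last first.
      by rewrite -!scalerAl -!scalerAr !scalerA mulrC.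
    rewrite scale_shuffle nhermfS /u; case: k => [|k].
      by rewrite subr0 mulr0 subr0 scale_shuffle1.
    by rewrite (exprS (s *: q)) scale_shuffle2.
  under eq_bigr => k _ do rewrite -/(dpow k.+1 (s *: q) ((1 * t) *: q)) term.
  rewrite sumrB -!mulr_sumr; congr (_ - _ * _).
  by case: n => [|n]; [rewrite big_nil|rewrite big_nat_recl//= add0r].
apply: cvgB.
  by apply: qcvgM; [exact: cvg_cst|exact: cF].
apply: qcvgM; first exact: cvg_cst.
rewrite -cvg_shiftS; exact: cF.
Qed.

Lemma bargmann_kernelE (q : H) x :
  bargmann_kernel q x = pser (fun k => (nhermf k x)%:A) q.
Proof.
set c : R := pi `^ (- 4^-1).
pose F := pser (fun k => (nhermf k x)%:A : H).
pose w (s : R) : H := (x ^+ 2 / 2 - 0 * s)%:A + ((- (s2 * x) * s) *: q + (2^-1 * s ^+ 2) *: q ^+ 2).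
have dw s : is_diff s w (fun t => (- (s2 * x) * t) *: q + (s * t) *: q ^+ 2).
  have d1 : is_diff s (fun t : R => (- (s2 * x) * t) *: q) (fun t => (- (s2 * x) * t) *: q).
    apply: is_diff_scale_curve.
    by apply: is_derive_eq; rewrite -[_ *: 1]/(_ * 1) mulr1.
  have d2 : is_diff s (fun t : R => (2^-1 * t ^+ 2) *: q ^+ 2) (fun t => (s * t) *: q ^+ 2).
    apply: is_diff_scale_curve.
    by apply: is_derive_eq; rewrite /GRing.scale /= !mulr1; field.
  have d0 : is_diff s (fun t : R => (x ^+ 2 / 2 - 0 * t)%:A : H) (fun=> 0).
    have -> : (fun t : R => (x ^+ 2 / 2 - 0 * t)%:A : H) = cst (x ^+ 2 / 2)%:A.
      by apply/funext => t; rewrite mul0r subr0.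
    exact: is_diff_cst.
  apply: is_diff_eq (is_diffD d0 (is_diffD d1 d2)) _.
  by apply/funext => t; rewrite !fctE add0r.
have cq (a b d e f : R) : (a%:A + (b *: q + d *: q ^+ 2)) * (e *: q + f *: q ^+ 2) =
    (e *: q + f *: q ^+ 2) * (a%:A + (b *: q + d *: q ^+ 2)).
  have cqP (u v : R) : q * (u *: q + v *: q ^+ 2) = (u *: q + v *: q ^+ 2) * q.
    by rewrite mulrDr mulrDl -!scalerAr -!scalerAl -exprS -exprSr.
  have comX (P : H) : q * P = P * q -> P * q ^+ 2 = q ^+ 2 * P.
    by move=> h; rewrite expr2 mulrA -h -mulrA -h mulrA.
  rewrite mulrDl [RHS]mulrDr -scalerAl -scalerAr mul1r mulr1; congr (_ + _).
  rewrite [LHS]mulrDr [RHS]mulrDl -!scalerAr -!scalerAl cqP; congr (_ + _ *: _).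
  exact/comX/cqP.
have dqw s := is_diff_qexp_curve (dw s) (fun t => cq _ _ _ _ _).
(* The two factors solve opposite linear differential equations. *)
pose Y (s : R) := qexp (w s) * F (s *: q).
have dY s : is_diff s Y (fun=> 0).
  apply: is_diff_eq (is_diff_qmul (dqw s) (is_diff_nhermf_series q x s)) _.
  apply/funext => t.
  have cE : (- (s2 * x) * t) *: q + (s * t) *: q ^+ 2 = 
      - ((t * (s2 * x)) *: q - (t * s) *: q ^+ 2).
    by rewrite opprB addrC mulNr scaleNr [s * t]mulrC [t * (s2 * x)]mulrC.
  rewrite -mulrBl cE -(qexp_comm (e := - _)); last by rewrite -cE; exact: cq.
  by rewrite !mulrA -mulrDl -mulrDr addrN mulr0 mul0r.
have E := is_diff0_cst dY 1 0.
have w0 : Y 0 = c%:A.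
  rewrite /Y /w !mulr0 expr0n /= mulr0 !scale0r subr0 !addr0 qexp_real.
  have -> : F 0 = (nhermf 0 x)%:A by exact: pser0.
  rewrite -scalerAl mul1r scalerA /nhermf /nherm /= mulr1 mulrCA expRxMexpNx_1.
  by rewrite mulr1.
rewrite /bargmann_kernel -/c.
have -> : - (2^-1 *: (q ^+ 2 + (x ^+ 2)%:A)) + (Num.sqrt 2 * x) *: q = - w 1.
  have -> : w 1 = 2^-1 *: (x ^+ 2)%:A + (- ((s2 * x) *: q) + 2^-1 *: q ^+ 2).
    by rewrite /w mul0r subr0 !mulr1 expr1n mulr1 scaleNr scalerA [_ / 2]mulrC.
  have sub3 (A B C : H) : - (B + A) + C = - (A + (- C + B)).
    by rewrite !opprD opprK addrAC addrC [C - B]addrC.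
  by rewrite scalerDr sub3.
transitivity (qexp (- w 1) * Y 0).
  by rewrite w0 -scalerAr mulr1.
by rewrite -E /Y mulrA -{2}[w 1]opprK qexpN mul1r scale1r.
Qed.

End Hermite.

(** * Gaussian integrals on the line *)

Section RealIntegrals.
Context d (T : measurableType d) (R : realType) (mu : {measure set T -> \bar R}).
Implicit Types f g h : T -> R.

Lemma integrable_le f g : measurable_fun setT f ->
  (forall x, `|f x| <= g x) -> mu.-integrable setT (fun x => (g x)%:E) ->
  mu.-integrable setT (fun x => (f x)%:E).
Proof.
move=> mf fg; apply: le_integrable => //; first exact/measurable_EFinP.
by move=> x _ /=; rewrite lee_fin; apply: le_trans (fg x) _; exact: ler_norm.
Qed.

Lemma Rintegral_dominated (f_ : nat -> T -> R) f g :
  (forall n, measurable_fun setT (f_ n)) ->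
  (forall x, f_ ^~ x @ \oo --> f x) ->
  (forall n x, `|f_ n x| <= g x) -> mu.-integrable setT (fun x => (g x)%:E) ->
  mu.-integrable setT (fun x => (f x)%:E) /\
  (\int[mu]_x f_ n x)%R @[n --> \oo] --> (\int[mu]_x f x)%R.
Proof.
move=> mf cf fg ig.
have mlim : measurable_fun setT f.
  apply: (@measurable_fun_cvg _ _ _ setT f_) => //.
have mf_E n : measurable_fun setT (EFin \o f_ n) by exact/measurable_EFinP.
have mfE : measurable_fun setT (EFin \o f) by exact/measurable_EFinP.
have cE : {ae mu, forall x, setT x -> (EFin \o f_ n) x @[n --> \oo] --> (EFin \o f) x}.
  by apply/aeW => x _; apply/fine_cvgP; split; [exact: nearW|exact: cf].
have leE : {ae mu, forall x n, setT x -> (`|(EFin \o f_ n) x| <= (EFin \o g) x)%E}.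
  by apply/aeW => x n _ /=; rewrite lee_fin.
have [i1 _ c] := dominated_convergence measurableT mf_E mfE cE ig leE.
split => //.
have /fine_cvgP[_] : ((\int[mu]_x (f_ n x)%:E)%E @[n --> \oo] --> (\int[mu]_x f x)%R%:E)%E.
  by rewrite /Rintegral fineK//; exact: integrable_fin_num.
by [].
Qed.

Lemma integrableR_Z (k : R) f : mu.-integrable setT (fun x => (f x)%:E) ->
  mu.-integrable setT (fun x => (k * f x)%:E).
Proof. by move=> fi; exact: (integrableZl measurableT k fi). Qed.

Lemma integrableR_D f g : mu.-integrable setT (fun x => (f x)%:E) ->
  mu.-integrable setT (fun x => (g x)%:E) ->
  mu.-integrable setT (fun x => (f x + g x)%:E).
Proof. by move=> fi gi; exact: (integrableD measurableT fi gi). Qed.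

Lemma integrableR_sum (I : Type) (s : seq I) (F : I -> T -> R) :
  (forall i, mu.-integrable setT (fun x => (F i x)%:E)) ->
  mu.-integrable setT (fun x => (\sum_(i <- s) F i x)%:E).
Proof.
move=> Fi; elim: s => [|i s IH].
  by under eq_fun do rewrite big_nil; exact: integrable0.
by under eq_fun do rewrite big_cons; exact: integrableR_D.
Qed.

Lemma RintegralR_sum (I : Type) (s : seq I) (F : I -> T -> R) :
  (forall i, mu.-integrable setT (fun x => (F i x)%:E)) ->
  (\int[mu]_x (\sum_(i <- s) F i x))%R = \sum_(i <- s) (\int[mu]_x F i x)%R.
Proof.
move=> Fi; elim: s => [|i s IH].
  rewrite big_nil; under eq_Rintegral do rewrite big_nil.
  by rewrite /Rintegral integral0.
rewrite big_cons -IH; under eq_Rintegral do rewrite big_cons.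
exact: (RintegralD measurableT (Fi i) (integrableR_sum s Fi)).
Qed.

Lemma integrable_sq_mul f g : measurable_fun setT f -> measurable_fun setT g ->
  mu.-integrable setT (fun x => (f x ^+ 2)%:E) ->
  mu.-integrable setT (fun x => (g x ^+ 2)%:E) ->
  mu.-integrable setT (fun x => (f x * g x)%:E).
Proof.
move=> mf mg f2 g2; apply: (@integrable_le _ (fun x => f x ^+ 2 + g x ^+ 2)).
- exact: measurable_funM.
- move=> x; rewrite normrM -(real_normK (num_real (f x))) -(real_normK (num_real (g x))).
  have := sqr_ge0 (`|f x| - `|g x|); have := sqr_ge0 `|f x|; have := sqr_ge0 `|g x|.
  nra.
- exact: (integrableD measurableT f2 g2).
Qed.

End RealIntegrals.

Section Tempered.
Context d (T : measurableType d) (R : realType) (nu : T -> R).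
Hypothesis nu0 : forall t, 0 <= nu t.
Implicit Types f g : T -> R.

Definition tempered f := measurable_fun setT f /\
  exists C c : R, forall t, `|f t| <= C * expR (c * nu t).

Lemma temperedP f : tempered f -> measurable_fun setT f /\
  exists C c : R, [/\ 0 <= C, 0 <= c & forall t, `|f t| <= C * expR (c * nu t)].
Proof.
move=> [mf [C [c fC]]]; split=> //; exists `|C|, `|c|; split=> // t.
apply: le_trans (fC t) _; apply: le_trans (_ : `|C| * expR (c * nu t) <= _).
  by rewrite ler_wpM2r ?expR_ge0 ?ler_norm.
by rewrite ler_wpM2l// ler_expR ler_wpM2r// ler_norm.
Qed.

Lemma temperedD f g : tempered f -> tempered g -> tempered (fun t => f t + g t).
Proof.
move=> /temperedP[mf [C [c [C0 c0 fC]]]] /temperedP[mg [D [e [D0 e0 gD]]]].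
split; first exact: measurable_funD.
exists (C + D), (c + e) => t; apply: le_trans (ler_normD _ _) _.
rewrite mulrDl; apply: lerD.
  apply: le_trans (fC t) _; rewrite ler_wpM2l// ler_expR mulrDl lerDl mulr_ge0//.
apply: le_trans (gD t) _; rewrite ler_wpM2l// ler_expR mulrDl lerDr mulr_ge0//.
Qed.

Lemma temperedM f g : tempered f -> tempered g -> tempered (fun t => f t * g t).
Proof.
move=> [mf [C [c fC]]] [mg [D [e gD]]].
split; first exact: measurable_funM.
exists (C * D), (c + e) => t; rewrite normrM mulrDl expRD mulrACA.
by apply: ler_pM.
Qed.

Lemma tempered_cst (a : R) : tempered (fun=> a).
Proof.
split; first exact: measurable_cst.
by exists `|a|, 0 => t; rewrite mul0r expR0 mulr1.
Qed.

Lemma temperedN f : tempered f -> tempered (fun t => - f t).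
Proof.
move=> tf; have := temperedM (tempered_cst (-1)) tf.
by congr tempered; apply/funext => t; rewrite mulN1r.
Qed.

Lemma temperedB f g : tempered f -> tempered g -> tempered (fun t => f t - g t).
Proof. by move=> tf tg; apply: temperedD => //; exact: temperedN. Qed.

End Tempered.

Section Gaussian1.
Context {R : realType}.
Local Notation mu := (@lebesgue_measure R).
Implicit Types f g : R -> R.

Definition tempered1 := tempered (fun x : R => `|x|).

Lemma integrable_gauss (a : R) : 0 < a ->
  mu.-integrable setT (fun x : R => (expR (- (a * x ^+ 2)))%:E).
Proof.
move=> a0; pose s := Num.sqrt ((2 * a)^-1).
have s0 : s != 0 by rewrite gt_eqF// sqrtr_gt0 invr_gt0 mulr_gt0.
have := integrableZl measurableT (normal_peak s)^-1 (integrable_normal_pdf 0 s).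
congr (mu.-integrable setT); apply/funext => x.
rewrite normal_pdfE// -EFinM mulrA mulVf ?mul1r ?gt_eqF ?normal_peak_gt0//.
rewrite /normal_fun subr0 /s sqr_sqrtr ?invr_ge0 ?mulr_ge0// ?ltW//.
congr (expR _)%:E; field; rewrite gt_eqF//.
Qed.

Lemma expR_gauss_le (a c x : R) : 0 < a ->
  c * x - a * x ^+ 2 <= c ^+ 2 / (2 * a) - a / 2 * x ^+ 2.
Proof.
move=> a0; rewrite -subr_ge0.
have -> : c ^+ 2 / (2 * a) - a / 2 * x ^+ 2 - (c * x - a * x ^+ 2) =
    (c - a * x) ^+ 2 / (2 * a) by field; rewrite gt_eqF.
by rewrite divr_ge0 ?sqr_ge0// mulr_ge0// ltW.
Qed.

Lemma tempered1_gauss_le f (a : R) : 0 < a -> tempered1 f ->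
  exists K, forall x, `|f x * expR (- (a * x ^+ 2))| <= K * expR (- (a / 2 * x ^+ 2)).
Proof.
move=> a0 /(temperedP (nu := fun x : R => `|x|) (fun=> normr_ge0 _)).
move=> [_ [C [c [C0 c0 fC]]]].
exists (C * expR (c ^+ 2 / (2 * a))) => x.
rewrite normrM [`|expR _|]ger0_norm ?expR_ge0//.
apply: le_trans (ler_wpM2r (expR_ge0 _) (fC x)) _.
rewrite -[leLHS]mulrA -expRD -[leRHS]mulrA -expRD ler_wpM2l// ler_expR -(real_normK (num_real x)).
exact: expR_gauss_le.
Qed.

Lemma tempered1_integrable f (a : R) : 0 < a -> tempered1 f ->
  mu.-integrable setT (fun x => (f x * expR (- (a * x ^+ 2)))%:E).
Proof.
move=> a0 tf; have [K fK] := tempered1_gauss_le a0 tf.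
apply: (integrable_le (mu := mu) _ fK).
  apply: measurable_funM; first by case: tf.
  apply: measurableT_comp => //; apply: measurableT_comp => //.
  by apply: measurable_funM => //; exact: measurable_funX.
have a20 : 0 < a / 2 by rewrite divr_gt0.
exact: (integrableR_Z K (integrable_gauss a20)).
Qed.

End Gaussian1.

Section GaussianParts.
Context {R : realType}.
Local Notation mu := (@lebesgue_measure R).
Implicit Types f g : R -> R.

Lemma tempered1_id : tempered1 (@idfun R).
Proof.
split; first exact: measurable_id.
exists 1, 1 => x; rewrite !mul1r; apply: le_trans (expR_ge1Dx _).
by rewrite lerDr.
Qed.

Lemma tempered1_gauss_cvg0 g (u : nat -> R) : tempered1 g ->
  (forall n, n%:R <= `|u n|) ->
  (g (u n) * expR (- u n ^+ 2)) @[n --> \oo] --> (0 : R).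
Proof.
move=> /(temperedP (nu := fun x : R => `|x|) (fun=> normr_ge0 _)).
move=> [_ [C [c [C0 c0 gC]]]] un.
have a0 : 0 < 1 :> R by [].
apply/norm_cvg0P.
apply: (@squeeze_cvgr _ _ _ _ (fun=> 0) (fun n : nat => C * expR ((c + 1) ^+ 2 / 2) * expR (- n%:R))).
- apply: nearW => n; rewrite normr_ge0 /= normrM [`|expR _|]ger0_norm ?expR_ge0//.
  apply: le_trans (ler_wpM2r (expR_ge0 _) (gC _)) _.
  rewrite -[leLHS]mulrA -expRD -[leRHS]mulrA -expRD ler_wpM2l// ler_expR.
  have := expR_gauss_le (c + 1) `|u n| a0; rewrite mulr1 mul1r.
  have := un n; have := sqr_ge0 `|u n|; rewrite -(real_normK (num_real (u n))).
  lra.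
- exact: cvg_cst.
- rewrite -[X in _ --> X](mulr0 (C * expR ((c + 1) ^+ 2 / 2))).
  by apply: cvgMl_tmp; exact: cvgn_expR.
Qed.

Lemma gauss_by_parts g (dg : R -> R) :
  (forall x : R, is_derive x 1 g (dg x)) -> continuous dg ->
  tempered1 g -> tempered1 dg ->
  (\int[mu]_x ((dg x - 2 * x * g x) * expR (- x ^+ 2)))%R = 0.
Proof.
move=> gd cdg tg tdg.
pose G (x : R) := g x * expR (- x ^+ 2).
pose F (x : R) := (dg x - 2 * x * g x) * expR (- x ^+ 2).
have Gd (x : R) : is_derive x 1 G (F x).
  have := gd x => ?; apply: is_derive_eq.
  by rewrite /GRing.scale /= /F; ring.
have tF : tempered1 (fun x => dg x - 2 * x * g x).
  apply: temperedB => //; apply: temperedM => //; apply: temperedM.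
    exact: tempered_cst.
  exact: tempered1_id.
have iF : mu.-integrable setT (fun x => (F x)%:E).
  have := tempered1_integrable ltr01 tF.
  by congr (mu.-integrable setT); apply/funext => x; rewrite mul1r.
have cF : continuous F.
  move=> x; apply: cvgM.
    apply: cvgB; first exact: cdg.
    apply: cvgM; first by apply: cvgM; [exact: cvg_cst|exact: cvg_id].
    by apply: differentiable_continuous; apply/derivable1_diffP; case: (gd x).
  exact: continuous_gauss_fun.
pose D (n : nat) : set R := [set` `[- (n.+1%:R : R), n.+1%:R]].
have E n : (\int[mu]_x (F \_ (D n)) x)%R = G n.+1%:R - G (- n.+1%:R).
  rewrite -Rintegral_mkcond /Rintegral.
  rewrite (@continuous_FTC2 _ F G) //.
  - have n0 : 0 < n.+1%:R :> R by rewrite ltr0n. lra.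
  - by apply: continuous_subspaceT.
  - have cG : continuous G.
      by move=> x; apply: differentiable_continuous; apply/derivable1_diffP; case: (Gd x).
    split => [x _||]; first by case: (Gd x).
      exact: cvg_at_right_filter (cG _).
    exact: cvg_at_left_filter (cG _).
  - by move=> x _; rewrite derive1E; case: (Gd x).
have [] := @Rintegral_dominated _ _ R mu (fun n => F \_ (D n)) F (fun x => `|F x|).
- move=> n; have mD : measurable (D n) by exact: measurable_itv.
  have mF : measurable_fun setT F by apply/measurable_EFinP; exact: measurable_int iF.
  apply: (iffLR (measurable_restrictT F mD)). exact: measurable_funTS mF.
- move=> x; apply: cvg_near_cst; near=> n.
  rewrite patchE mem_set// /D /= in_itv /= -ler_norml.
  apply: (@le_trans _ _ n%:R); last by rewrite ler_nat.
  by near: n; exact: nbhs_infty_ger.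
- by move=> n x; rewrite patchE; case: ifPn => _ //; rewrite normr0.
- exact: integrable_norm iF.
move=> _; under eq_fun do rewrite E.
move=> cF0; apply: (cvg_unique _ cF0) => //=.
rewrite -[X in _ --> X](subr0 0); apply: cvgB; apply: tempered1_gauss_cvg0 => // n.
  by rewrite normr_nat ler_nat.
by rewrite normrN normr_nat ler_nat.
Unshelve. all: by end_near. Qed.

End GaussianParts.

Section HermiteOrthogonality.
Context {R : realType}.
Local Notation mu := (@lebesgue_measure R).
Local Notation s2 := (Num.sqrt 2 : R).

Lemma continuous_derivable (f df : R -> R) :
  (forall x : R, is_derive x 1 f (df x)) -> continuous f.
Proof.
move=> fd x; apply: differentiable_continuous; apply/derivable1_diffP.
by case: (fd x).
Qed.

Lemma continuous_nherm k : continuous (@nherm R k).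
Proof.
exact: (continuous_derivable (fun x => is_derive_nherm k x)).
Qed.

Lemma tempered1_nherm k : tempered1 (@nherm R k).
Proof.
split; first by apply: continuous_measurable_fun; exact: continuous_nherm.
exists (expR 1), s2 => x; rewrite -expRD.
have := nherm_le k x (@ler01 R); rewrite !expr1n !mulr1 addrC.
by [].
Qed.

Lemma tempered1_nherm_pred k : tempered1 (@nherm_pred R k).
Proof. by case: k => [|k]; [exact: tempered_cst|exact: tempered1_nherm]. Qed.

Lemma continuous_nherm_pred k : continuous (@nherm_pred R k).
Proof. by case: k => [|k]; [exact: cst_continuous|exact: continuous_nherm]. Qed.

Definition gauss_int (f : R -> R) := (\int[mu]_x (f x * expR (- x ^+ 2)))%R.

Lemma tempered1_integrable_gauss f : tempered1 f ->
  mu.-integrable setT (fun x => (f x * expR (- x ^+ 2))%:E).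
Proof.
move=> tf; have := tempered1_integrable ltr01 tf.
by congr (mu.-integrable setT); apply/funext => x; rewrite mul1r.
Qed.

Lemma gauss_intZ (c : R) f : tempered1 f ->
  gauss_int (fun x => c * f x) = c * gauss_int f.
Proof.
move=> tf; rewrite /gauss_int; under eq_Rintegral do rewrite -mulrA.
exact: (RintegralZl _ measurableT (tempered1_integrable_gauss tf)).
Qed.

Lemma gauss_int_nhermS m k :
  m.+1%:R * gauss_int (fun x => nherm m.+1 x * nherm k x) =
  gauss_int (fun x => nherm m x * nherm_pred k x).
Proof.
have tm := tempered1_nherm; have tp := tempered1_nherm_pred.
have s2_neq0 : s2 != 0 by rewrite gt_eqF// sqrtr_gt0.
have s2_sqr : s2 * s2 = 2 by rewrite -expr2 sqr_sqrtr.
pose dg x := nherm m x * (s2 * nherm_pred k x) + nherm k x * (s2 * nherm_pred m x).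
have tdg : tempered1 dg.
  by apply: temperedD => //; (apply: temperedM; first exact: tm);
    (apply: temperedM; [exact: tempered_cst|exact: tp]).
have gd (x : R) : is_derive x 1 (fun x => nherm m x * nherm k x) (dg x).
  have d1 := is_derive_nherm m x; have d2 := is_derive_nherm k x.
  exact: is_deriveM.
have cdg : continuous dg.
  by move=> x; apply: cvgD; apply: cvgM; (try exact: continuous_nherm);
    (apply: cvgM; [exact: cvg_cst|exact: continuous_nherm_pred]).
have := gauss_by_parts gd cdg (temperedM (tm m) (tm k)) tdg.
have -> : (fun x => (dg x - 2 * x * (nherm m x * nherm k x)) * expR (- x ^+ 2)) =
  (fun x => s2 * (nherm m x * nherm_pred k x) * expR (- x ^+ 2) -
    (s2 * m.+1%:R) * (nherm m.+1 x * nherm k x) * expR (- x ^+ 2)).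
  apply/funext => x; rewrite -mulrBl; congr (_ * _).
  have -> : s2 * m.+1%:R * (nherm m.+1 x * nherm k x) =
      s2 * (m.+1%:R * nherm m.+1 x) * nherm k x by ring.
  rewrite nhermS /dg; move: (Num.sqrt 2) s2_sqr => r <-.
  move: (nherm m x) (nherm k x) (nherm_pred m x) (nherm_pred k x) => a b e f.
  by ring.
rewrite RintegralB//; last 2 first.
- apply: (tempered1_integrable_gauss (f := fun x => s2 * (nherm m x * nherm_pred k x))).
  by apply: temperedM; [exact: tempered_cst|exact: (temperedM (tm m) (tp k))].
- apply: (tempered1_integrable_gauss (f := fun x => s2 * m.+1%:R * (nherm m.+1 x * nherm k x))).
  by apply: temperedM; [exact: tempered_cst|exact: (temperedM (tm m.+1) (tm k))].
rewrite -!/(gauss_int _) (gauss_intZ _ (temperedM (tm m) (tp k))) (gauss_intZ _ (temperedM (tm m.+1) (tm k))).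
move=> /eqP; rewrite subr_eq0 -mulrA => /eqP.
by move/(mulfI s2_neq0).
Qed.

Lemma gauss_int_nherm m k :
  gauss_int (fun x => nherm m x * nherm k x) =
  if m == k then (m`!%:R)^-1 * Num.sqrt pi else 0.
Proof.
have int0 : gauss_int (fun=> 0) = 0.
  by rewrite /gauss_int; under eq_Rintegral do rewrite mul0r; rewrite /Rintegral integral0.
have S0 j : gauss_int (fun x => nherm j.+1 x * nherm 0 x) = 0.
  have := gauss_int_nhermS j 0; rewrite /nherm_pred /=.
  rewrite [RHS](_ : _ = 0) => [/eqP|]; last first.
    by rewrite -[RHS]int0; congr gauss_int; apply/funext => x; rewrite mulr0.
  by rewrite mulf_eq0 pnatr_eq0 /= => /eqP.
elim: m k => [|m IH] [|k].
- rewrite eqxx fact0 invr1 mul1r /gauss_int /nherm /=.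
  under eq_Rintegral do rewrite !mul1r.
  by rewrite /Rintegral integralT_gauss.
- rewrite -[RHS](S0 k) /=; congr gauss_int; apply/funext => x; exact: mulrC.
- exact: S0.
- have := gauss_int_nhermS m k.+1; rewrite -[nherm_pred k.+1]/(nherm k) IH eqSS.
  have m0 : m.+1%:R != 0 :> R by rewrite pnatr_eq0.
  move=> /(congr1 (fun t => m.+1%:R^-1 * t)); rewrite mulKf// => ->.
  by case: ifP => _; rewrite ?mulr0// factS natrM invfM mulrA.
Qed.

Lemma nhermf_mul m k (x : R) : nhermf m x * nhermf k x =
  (Num.sqrt pi)^-1 * (nherm m x * nherm k x * expR (- x ^+ 2)).
Proof.
have -> : expR (- x ^+ 2) = expR (- (x ^+ 2 / 2)) ^+ 2.
  by rewrite -expRM_natl; congr expR; field.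
have <- : (pi : R) `^ (- 4^-1) ^+ 2 = (Num.sqrt pi)^-1.
  rewrite -powR_mulrn ?powR_ge0// -powRrM -powR12_sqrt ?pi_ge0// -powRN.
  by congr powR; field.
by rewrite /nhermf; ring.
Qed.

Lemma integrable_nhermf_mul m k :
  mu.-integrable setT (fun x => (nhermf m x * nhermf k x)%:E).
Proof.
under eq_fun do rewrite nhermf_mul.
apply: integrableR_Z; apply: (tempered1_integrable_gauss (f := fun x => nherm m x * nherm k x)).
exact: (temperedM (tempered1_nherm m) (tempered1_nherm k)).
Qed.

Lemma nhermf_ortho m k :
  (\int[mu]_x (nhermf m x * nhermf k x))%R = if m == k then (m`!%:R)^-1 else 0.
Proof.
under eq_Rintegral do rewrite nhermf_mul.
rewrite RintegralZl//; last first.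
  apply: (tempered1_integrable_gauss (f := fun x => nherm m x * nherm k x)).
  exact: (temperedM (tempered1_nherm m) (tempered1_nherm k)).
rewrite -/(gauss_int _) gauss_int_nherm; case: ifP => _; last by rewrite mulr0.
by rewrite mulrC mulfK// gt_eqF// sqrtr_gt0 pi_gt0.
Qed.

Lemma measurable_nhermf k : measurable_fun setT (@nhermf R k).
Proof.
apply: measurable_funM; last by apply: continuous_measurable_fun; exact: continuous_nherm.
apply: measurable_funM => //; apply: measurableT_comp => //; apply: measurableT_comp => //.
by apply: measurable_funM => //; exact: measurable_funX.
Qed.

End HermiteOrthogonality.

(** * Gaussian integrals on the plane *)

Section Gaussian2.
Context {R : realType}.
Local Notation mu := (@lebesgue_measure R).
Local Notation mu2 := (@lebesgue2 R).
Implicit Types f g : R * R -> R.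

Definition norm1 (z : R * R) : R := `|z.1| + `|z.2|.
Definition tempered2 := tempered norm1.

Lemma norm1_ge0 z : 0 <= norm1 z. Proof. by rewrite addr_ge0. Qed.

Lemma measurable_gauss2 (a : R) :
  measurable_fun setT (fun z : R * R => expR (- (a * (z.1 ^+ 2 + z.2 ^+ 2)))).
Proof.
apply: measurableT_comp => //; apply: measurableT_comp => //.
apply: measurable_funM => //; apply: measurable_funD; apply: measurable_funX => //.
Qed.

Lemma integrable_gauss2 (a : R) : 0 < a ->
  mu2.-integrable setT (fun z => (expR (- (a * (z.1 ^+ 2 + z.2 ^+ 2))))%:E).
Proof.
move=> a0; apply/integrable12ltyP.
  by apply/measurable_EFinP; exact: measurable_gauss2.
have ig := integrable_gauss a0.
have fin := integrable_fin_num measurableT ig.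
pose c := fine (\int[mu]_x (expR (- (a * x ^+ 2)))%:E)%E.
have -> : (\int[mu]_x \int[mu]_y `|(expR (- (a * ((x, y).1 ^+ 2 + (x, y).2 ^+ 2))))%:E|)%E =
    (\int[mu]_x (expR (- (a * x ^+ 2)) * c)%:E)%E.
  apply: eq_integral => x _.
  rewrite EFinM /c fineK// -integralZl//.
  apply: eq_integral => y _ /=.
  by rewrite ger0_norm ?expR_ge0// -EFinM -expRD mulrDr opprD.
apply: integrable_lty => //.
by have := integrableR_Z c ig; congr (mu.-integrable setT); apply/funext => x; rewrite mulrC.
Qed.

Lemma tempered2_gauss_le f (a : R) : 0 < a -> tempered2 f ->
  exists K, forall z, `|f z * expR (- (a * (z.1 ^+ 2 + z.2 ^+ 2)))| <=
    K * expR (- (a / 2 * (z.1 ^+ 2 + z.2 ^+ 2))).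
Proof.
move=> a0 /(temperedP norm1_ge0)[_ [C [c [C0 c0 fC]]]].
exists (C * expR (c ^+ 2 / (2 * a) + c ^+ 2 / (2 * a))) => z.
rewrite normrM [`|expR _|]ger0_norm ?expR_ge0//.
apply: le_trans (ler_wpM2r (expR_ge0 _) (fC z)) _.
rewrite -[leLHS]mulrA -expRD -[leRHS]mulrA -expRD ler_wpM2l// ler_expR.
rewrite -(real_normK (num_real z.1)) -(real_normK (num_real z.2)) /norm1.
have := expR_gauss_le c `|z.1| a0; have := expR_gauss_le c `|z.2| a0.
lra.
Qed.

Lemma tempered2_integrable f (a : R) : 0 < a -> tempered2 f ->
  mu2.-integrable setT (fun z => (f z * expR (- (a * (z.1 ^+ 2 + z.2 ^+ 2))))%:E).
Proof.
move=> a0 tf; have [K fK] := tempered2_gauss_le a0 tf.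
apply: (integrable_le (mu := mu2) _ fK).
  by apply: measurable_funM; [case: tf|exact: measurable_gauss2].
apply: integrableR_Z; apply: integrable_gauss2.
by rewrite divr_gt0.
Qed.

Definition gauss_int2 f := (\int[mu2]_z (f z * expR (- (z.1 ^+ 2 + z.2 ^+ 2))))%R.

Lemma tempered2_integrable_gauss f : tempered2 f ->
  mu2.-integrable setT (fun z => (f z * expR (- (z.1 ^+ 2 + z.2 ^+ 2)))%:E).
Proof.
move=> tf; have := tempered2_integrable ltr01 tf.
by congr (mu2.-integrable setT); apply/funext => x; rewrite mul1r.
Qed.

Lemma gauss_int2Z (c : R) f : tempered2 f ->
  gauss_int2 (fun z => c * f z) = c * gauss_int2 f.
Proof.
move=> tf; rewrite /gauss_int2; under eq_Rintegral do rewrite -mulrA.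
exact: (RintegralZl _ measurableT (tempered2_integrable_gauss tf)).
Qed.

Lemma gauss_int2D f g : tempered2 f -> tempered2 g ->
  gauss_int2 (fun z => f z + g z) = gauss_int2 f + gauss_int2 g.
Proof.
move=> tf tg; rewrite /gauss_int2; under eq_Rintegral do rewrite mulrDl.
exact: (RintegralD measurableT (tempered2_integrable_gauss tf) (tempered2_integrable_gauss tg)).
Qed.

Lemma gauss_int2B f g : tempered2 f -> tempered2 g ->
  gauss_int2 (fun z => f z - g z) = gauss_int2 f - gauss_int2 g.
Proof.
move=> tf tg; rewrite /gauss_int2; under eq_Rintegral do rewrite mulrBl.
exact: (RintegralB measurableT (tempered2_integrable_gauss tf) (tempered2_integrable_gauss tg)).
Qed.

Lemma tempered2_section1 f (y : R) : tempered2 f -> continuous (fun x => f (x, y)) ->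
  tempered1 (fun x => f (x, y)).
Proof.
move=> [_ [C [c fC]]] cf; split; first exact: continuous_measurable_fun.
exists (C * expR (c * `|y|)), c => x; apply: le_trans (fC _) _.
by rewrite -mulrA -expRD /norm1 /= mulrDr addrC.
Qed.

Lemma tempered2_section2 f (x : R) : tempered2 f -> continuous (fun y => f (x, y)) ->
  tempered1 (fun y => f (x, y)).
Proof.
move=> [_ [C [c fC]]] cf; split; first exact: continuous_measurable_fun.
exists (C * expR (c * `|x|)), c => y; apply: le_trans (fC _) _.
by rewrite -mulrA -expRD /norm1 /= mulrDr.
Qed.

Lemma tempered2_fst : tempered2 (fun z => z.1).
Proof.
split; first exact: measurable_fst.
exists 1, 1 => z; rewrite !mul1r; apply: le_trans (expR_ge1Dx _).
by rewrite /norm1; have := normr_ge0 z.2; lra.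
Qed.

Lemma tempered2_snd : tempered2 (fun z => z.2).
Proof.
split; first exact: measurable_snd.
exists 1, 1 => z; rewrite !mul1r; apply: le_trans (expR_ge1Dx _).
by rewrite /norm1; have := normr_ge0 z.1; lra.
Qed.

Lemma gauss_section_eq0 (h : R -> R) (b : R) : tempered1 h ->
  (\int[mu]_x (h x * expR (- x ^+ 2)))%R = 0 ->
  (\int[mu]_x (h x * expR (- x ^+ 2) * b)%:E = 0)%E.
Proof.
move=> th h0; have ih := tempered1_integrable_gauss th.
under eq_integral do rewrite EFinM.
rewrite integralZr// -(fineK (integrable_fin_num measurableT ih)).
by rewrite [fine _]h0 mul0e.
Qed.

Lemma gauss_int2_parts1 f (fx : R * R -> R) :
  (forall x y : R, is_derive x 1 (fun x => f (x, y)) (fx (x, y))) ->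
  (forall y, continuous (fun x => fx (x, y))) ->
  tempered2 f -> tempered2 fx ->
  gauss_int2 fx = 2 * gauss_int2 (fun z => z.1 * f z).
Proof.
move=> fd cfx tf tfx.
have tzf : tempered2 (fun z => z.1 * f z) by exact: (temperedM tempered2_fst tf).
have tzf2 : tempered2 (fun z => 2 * (z.1 * f z)) by exact: (temperedM (tempered_cst _ 2) tzf).
have ti := tempered2_integrable_gauss (temperedB norm1_ge0 tfx tzf2).
apply/eqP; rewrite -gauss_int2Z// -subr_eq0 -gauss_int2B//; apply/eqP.
rewrite /gauss_int2 /Rintegral -integral21_prod_meas1// -[RHS]/(fine 0%E); congr fine.
apply: integral0_eq => y _; rewrite /fubini_G /=.
have cf : continuous (fun x => f (x, y)) by exact: (continuous_derivable (fd^~ y)).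
have t1 := tempered2_section1 tf cf; have t1x := tempered2_section1 tfx (cfx y).
have th : tempered1 (fun x => fx (x, y) - 2 * x * f (x, y)).
  apply: temperedB => //; apply: temperedM => //.
  exact: (temperedM (tempered_cst _ 2) tempered1_id).
have := gauss_section_eq0 (expR (- y ^+ 2)) th (gauss_by_parts (fd^~ y) (cfx y) t1 t1x).
move=> <-; apply: eq_integral => x _.
by rewrite opprD expRD !mulrA.
Qed.

Lemma gauss_int2_parts2 f (fy : R * R -> R) :
  (forall x y : R, is_derive y 1 (fun y => f (x, y)) (fy (x, y))) ->
  (forall x, continuous (fun y => fy (x, y))) ->
  tempered2 f -> tempered2 fy ->
  gauss_int2 fy = 2 * gauss_int2 (fun z => z.2 * f z).
Proof.
move=> fd cfy tf tfy.
have tzf : tempered2 (fun z => z.2 * f z) by exact: (temperedM tempered2_snd tf).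
have tzf2 : tempered2 (fun z => 2 * (z.2 * f z)) by exact: (temperedM (tempered_cst _ 2) tzf).
have ti := tempered2_integrable_gauss (temperedB norm1_ge0 tfy tzf2).
apply/eqP; rewrite -gauss_int2Z// -subr_eq0 -gauss_int2B//; apply/eqP.
rewrite /gauss_int2 /Rintegral -integral12_prod_meas1// -[RHS]/(fine 0%E); congr fine.
apply: integral0_eq => x _; rewrite /fubini_F /=.
have cf : continuous (fun y => f (x, y)) by exact: (continuous_derivable (fd x)).
have t1 := tempered2_section2 tf cf; have t1y := tempered2_section2 tfy (cfy x).
have th : tempered1 (fun y => fy (x, y) - 2 * y * f (x, y)).
  apply: temperedB => //; apply: temperedM => //.
  exact: (temperedM (tempered_cst _ 2) tempered1_id).
have := gauss_section_eq0 (expR (- x ^+ 2)) th (gauss_by_parts (fd x) (cfy x) t1 t1y).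
move=> <-; apply: eq_integral => y _.
by rewrite [x ^+ 2 + _]addrC opprD expRD !mulrA.
Qed.

Lemma gauss_int2_1 : gauss_int2 (fun=> 1) = pi.
Proof.
have ti := tempered2_integrable_gauss (tempered_cst _ 1).
have ig := integrable_gauss (@ltr01 R).
have E1 : (\int[mu]_x (expR (- x ^+ 2))%:E = (Num.sqrt pi)%:E)%E by exact: integralT_gauss.
have i1 : mu.-integrable setT (fun x => (expR (- x ^+ 2))%:E).
  by move: ig; congr (mu.-integrable setT); apply/funext => x; rewrite mul1r.
rewrite /gauss_int2 /Rintegral -integral12_prod_meas1//.
have -> : (\int[mu]_x fubini_F mu (fun z : R * R => (1 * expR (- (z.1 ^+ 2 + z.2 ^+ 2)))%:E) x)%E =
    (\int[mu]_x ((Num.sqrt pi)%:E * (expR (- x ^+ 2))%:E))%E.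
  apply: eq_integral => x _; rewrite /fubini_F /= -E1.
  rewrite -integralZr//; apply: eq_integral => y _.
  by rewrite mul1r -EFinM opprD expRD mulrC.
by rewrite integralZl// E1 /= -expr2 sqr_sqrtr// pi_ge0.
Qed.

Fixpoint zpow k (z : R * R) : R * R :=
  if k is k'.+1 then
    (z.1 * (zpow k' z).1 - z.2 * (zpow k' z).2,
     z.2 * (zpow k' z).1 + z.1 * (zpow k' z).2)
  else (1, 0).

(* Real and imaginary parts of [conj z ^ k * z ^ m]. *)
Definition zmix_re k m z := (zpow k z).1 * (zpow m z).1 + (zpow k z).2 * (zpow m z).2.
Definition zmix_im k m z := (zpow k z).1 * (zpow m z).2 - (zpow k z).2 * (zpow m z).1.

End Gaussian2.

Section ComplexMoments.
Context {R : realType}.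
Local Notation H := (quaternion R).
Implicit Types (k m : nat) (z : R * R).

Lemma is_derive_zpow k (x y : R) :
  [/\ is_derive x 1 (fun x => (zpow k (x, y)).1) (k%:R * (zpow k.-1 (x, y)).1),
      is_derive x 1 (fun x => (zpow k (x, y)).2) (k%:R * (zpow k.-1 (x, y)).2),
      is_derive y 1 (fun y => (zpow k (x, y)).1) (- (k%:R * (zpow k.-1 (x, y)).2)) &
      is_derive y 1 (fun y => (zpow k (x, y)).2) (k%:R * (zpow k.-1 (x, y)).1)].
Proof.
elim: k => [|k [d1 d2 d3 d4]].
  by split=> /=; rewrite ?mul0r ?oppr0; exact: is_derive_cst.
have e1 : x * (k%:R * (zpow k.-1 (x, y)).1) - y * (k%:R * (zpow k.-1 (x, y)).2) =
    k%:R * (zpow k (x, y)).1.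
  by case: k {d1 d2 d3 d4} => [|k] /=; [rewrite !mul0r !mulr0 subr0|ring].
have e2 : y * (k%:R * (zpow k.-1 (x, y)).1) + x * (k%:R * (zpow k.-1 (x, y)).2) =
    k%:R * (zpow k (x, y)).2.
  by case: k {d1 d2 d3 d4 e1} => [|k] /=; [rewrite !mul0r !mulr0 addr0|ring].
have kS : k.+1%:R = k%:R + 1 :> R by rewrite natr1.
by split=> /=; apply: is_derive_eq;
  rewrite /GRing.scale /= ?mulr0 ?mulr1 ?add0r ?addr0 kS mulrDl mul1r -?e1 -?e2; ring.
Qed.

Lemma tempered2_zpow k : @tempered2 R (fun z => (zpow k z).1) /\ @tempered2 R (fun z => (zpow k z).2).
Proof.
elim: k => [|k [t1 t2]] /=; first by split; exact: tempered_cst.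
by split; [apply: (temperedB norm1_ge0)|apply: (temperedD norm1_ge0)];
  apply: temperedM => //; (exact: tempered2_fst || exact: tempered2_snd).
Qed.

Lemma tempered2_zmix k m : @tempered2 R (zmix_re k m) /\ @tempered2 R (zmix_im k m).
Proof.
have [k1 k2] := tempered2_zpow k; have [m1 m2] := tempered2_zpow m.
by split; [apply: (temperedD norm1_ge0)|apply: (temperedB norm1_ge0)];
  apply: temperedM.
Qed.

Lemma is_derive_zmix k m (x y : R) :
  [/\ is_derive x 1 (fun x => zmix_re k m (x, y))
        (k%:R * zmix_re k.-1 m (x, y) + m%:R * zmix_re k m.-1 (x, y)),
      is_derive x 1 (fun x => zmix_im k m (x, y))
        (k%:R * zmix_im k.-1 m (x, y) + m%:R * zmix_im k m.-1 (x, y)),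
      is_derive y 1 (fun y => zmix_re k m (x, y))
        (k%:R * zmix_im k.-1 m (x, y) - m%:R * zmix_im k m.-1 (x, y)) &
      is_derive y 1 (fun y => zmix_im k m (x, y))
        (m%:R * zmix_re k m.-1 (x, y) - k%:R * zmix_re k.-1 m (x, y))].
Proof.
have [a1 a2 a3 a4] := is_derive_zpow k x y; have [b1 b2 b3 b4] := is_derive_zpow m x y.
rewrite /zmix_re /zmix_im.
by split; apply: is_derive_eq; rewrite /GRing.scale /=; ring.
Qed.

Lemma continuous_zmix k m (x y : R) :
  [/\ {for x, continuous (fun x => zmix_re k m (x, y))},
      {for x, continuous (fun x => zmix_im k m (x, y))},
      {for y, continuous (fun y => zmix_re k m (x, y))} &
      {for y, continuous (fun y => zmix_im k m (x, y))}].
Proof.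
have [a1 a2 a3 a4] := is_derive_zmix k m x y.
by split; apply: differentiable_continuous; apply/derivable1_diffP;
  [case: a1|case: a2|case: a3|case: a4].
Qed.

(* With dzb = (d/dx + i d/dy) / 2 one has z e^(-|z|^2) = - dzb e^(-|z|^2), so
   a factor z integrates by parts to dzb, and dzb (conj z ^ k * z ^ m) =
   k conj z ^ (k - 1) * z ^ m. *)
Lemma gauss_int2_zmixS k m :
  @gauss_int2 R (zmix_re k m.+1) = k%:R * @gauss_int2 R (zmix_re k.-1 m) /\
  @gauss_int2 R (zmix_im k m.+1) = k%:R * @gauss_int2 R (zmix_im k.-1 m).
Proof.
have t i j := (tempered2_zmix i j).1; have t' i j := (tempered2_zmix i j).2.
have tc (c : R) i j := temperedM (tempered_cst norm1 c) (t i j).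
have tc' (c : R) i j := temperedM (tempered_cst norm1 c) (t' i j).
have cc (c d : R) (u v : R -> R) (x : R) : {for x, continuous u} -> {for x, continuous v} ->
    {for x, continuous (fun x => c * u x + d * v x)}.
  by move=> cu cv; apply: cvgD; (apply: cvgM; first exact: cvg_cst).
have cb (c d : R) (u v : R -> R) (x : R) : {for x, continuous u} -> {for x, continuous v} ->
    {for x, continuous (fun x => c * u x - d * v x)}.
  by move=> cu cv; apply: cvgB; (apply: cvgM; first exact: cvg_cst).
have E1 := @gauss_int2_parts1 R (zmix_re k m)
  (fun z => k%:R * zmix_re k.-1 m z + m%:R * zmix_re k m.-1 z)
  (fun x y => let: And4 a _ _ _ := is_derive_zmix k m x y in a)
  (fun y x => let: And4 a _ _ _ := continuous_zmix k.-1 m x y in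
    let: And4 b _ _ _ := continuous_zmix k m.-1 x y in cc _ _ _ _ _ a b)
  (t k m) (temperedD norm1_ge0 (tc _ _ _) (tc _ _ _)).
have E2 := @gauss_int2_parts1 R (zmix_im k m)
  (fun z => k%:R * zmix_im k.-1 m z + m%:R * zmix_im k m.-1 z)
  (fun x y => let: And4 _ a _ _ := is_derive_zmix k m x y in a)
  (fun y x => let: And4 _ a _ _ := continuous_zmix k.-1 m x y in
    let: And4 _ b _ _ := continuous_zmix k m.-1 x y in cc _ _ _ _ _ a b)
  (t' k m) (temperedD norm1_ge0 (tc' _ _ _) (tc' _ _ _)).
have E3 := @gauss_int2_parts2 R (zmix_re k m)
  (fun z => k%:R * zmix_im k.-1 m z - m%:R * zmix_im k m.-1 z)
  (fun x y => let: And4 _ _ a _ := is_derive_zmix k m x y in a)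
  (fun x y => let: And4 _ _ _ a := continuous_zmix k.-1 m x y in
    let: And4 _ _ _ b := continuous_zmix k m.-1 x y in cb _ _ _ _ _ a b)
  (t k m) (temperedB norm1_ge0 (tc' _ _ _) (tc' _ _ _)).
have E4 := @gauss_int2_parts2 R (zmix_im k m)
  (fun z => m%:R * zmix_re k m.-1 z - k%:R * zmix_re k.-1 m z)
  (fun x y => let: And4 _ _ _ a := is_derive_zmix k m x y in a)
  (fun x y => let: And4 _ _ a _ := continuous_zmix k m.-1 x y in
    let: And4 _ _ b _ := continuous_zmix k.-1 m x y in cb _ _ _ _ _ a b)
  (t' k m) (temperedB norm1_ge0 (tc _ _ _) (tc _ _ _)).
rewrite gauss_int2D ?gauss_int2Z // in E1; try exact: tc.
rewrite gauss_int2D ?gauss_int2Z // in E2; try exact: tc'.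
rewrite gauss_int2B ?gauss_int2Z // in E3; try exact: tc'.
rewrite gauss_int2B ?gauss_int2Z // in E4; try exact: tc.
have tx f : tempered2 f -> tempered2 (fun z : R * R => z.1 * f z).
  exact: (temperedM tempered2_fst).
have ty f : tempered2 f -> tempered2 (fun z : R * R => z.2 * f z).
  exact: (temperedM tempered2_snd).
have -> : zmix_re k m.+1 = fun z => z.1 * zmix_re k m z - z.2 * zmix_im k m z.
  by apply/funext => z; rewrite /zmix_re /zmix_im /=; ring.
have -> : zmix_im k m.+1 = fun z => z.1 * zmix_im k m z + z.2 * zmix_re k m z.
  by apply/funext => z; rewrite /zmix_re /zmix_im /=; ring.
rewrite (gauss_int2B (tx _ (t k m)) (ty _ (t' k m))).
rewrite (gauss_int2D (tx _ (t' k m)) (ty _ (t k m))).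
by split; lra.
Qed.

Lemma gauss_int2_zmix k m :
  @gauss_int2 R (zmix_re k m) = (if k == m then k`!%:R * pi else 0) /\
  @gauss_int2 R (zmix_im k m) = 0.
Proof.
have sym i j : @gauss_int2 R (zmix_re i j) = @gauss_int2 R (zmix_re j i) /\
    @gauss_int2 R (zmix_im i j) = - @gauss_int2 R (zmix_im j i).
  split; first by congr gauss_int2; apply/funext => z; rewrite /zmix_re; ring.
  rewrite -mulN1r -gauss_int2Z; last exact: (tempered2_zmix _ _).2.
  by congr gauss_int2; apply/funext => z; rewrite /zmix_im; ring.
elim: m k => [|m IH] [|k].
- rewrite eqxx fact0 mul1r -gauss_int2_1; split.
    by congr gauss_int2; apply/funext => z; rewrite /zmix_re /= !mulr1 mulr0 addr0.
  have := (sym 0 0)%N.2; lra.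
- have [s1 s2] := sym k.+1 0%N; rewrite s1 s2.
  by have [-> ->] := gauss_int2_zmixS 0 k; rewrite !mul0r oppr0.
- by have [-> ->] := gauss_int2_zmixS 0 m; rewrite !mul0r.
- have [-> ->] := gauss_int2_zmixS k.+1 m; have [-> ->] := IH k; rewrite eqSS mulr0.
  by split=> //; case: ifP => _; rewrite ?mulr0// factS natrM mulrA.
Qed.

Lemma imag_unitP (I : H) : imag_units I ->
  I 0 0 = 0 /\ I 0 1 ^+ 2 + I 0 2%:R ^+ 2 + I 0 3%:R ^+ 2 = 1.
Proof.
rewrite /imag_units /= expr2 => E.
have e i : (I * I) 0 i = (-1 : H) 0 i by rewrite E.
have := e 0; have := e 1; have := e 2%:R; have := e 3%:R.
rewrite !coordE; move: (I 0 0) (I 0 1) (I 0 2%:R) (I 0 3%:R) => a b c d e3 e2 e1 e0.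
have a0 : a = 0.
  apply/eqP; apply/negPn/negP => a0.
  have b0 : b = 0 by apply: (mulfI a0); lra.
  have c0 : c = 0 by apply: (mulfI a0); lra.
  have d0 : d = 0 by apply: (mulfI a0); lra.
  by have := sqr_ge0 a; move: e0; rewrite b0 c0 d0; lra.
by split=> //; move: e0; rewrite a0; lra.
Qed.

Variable I : H.
Hypothesis hI : imag_units I.

Let I2 : I * I = -1. Proof. by rewrite -expr2. Qed.
Lemma slice_ptE z : slice_pt I z = z.1%:A + z.2 *: I.
Proof. by rewrite /slice_pt -scalerAr mulr1. Qed.

Let mulAI (a b c d : R) : (a%:A + b *: I) * (c%:A + d *: I) =
  (a * c - b * d)%:A + (a * d + b * c) *: I.
Proof.
rewrite mulrDl !mulrDr -!scalerAl -!scalerAr !mul1r !mulr1 I2 !scalerA.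
by rewrite scalerBl scalerDl scalerN [X in _ + X]addrC addrACA.
Qed.

Lemma slice_ptX k z : slice_pt I z ^+ k = (zpow k z).1%:A + (zpow k z).2 *: I.
Proof.
elim: k => [|k IH]; first by rewrite expr0 /= scale1r scale0r addr0.
by rewrite exprS IH slice_ptE mulAI /= [z.2 * _ + _]addrC.
Qed.

Lemma qconj_slice_ptX k z :
  qconj (slice_pt I z) ^+ k = (zpow k z).1%:A - (zpow k z).2 *: I.
Proof.
rewrite -qconjX slice_ptX; move: (zpow k z).1 (zpow k z).2 => a b.
have [I0 _] := imag_unitP hI.
by apply: quatP; rewrite !coordE ?I0; ring.
Qed.

Lemma slice_pt_mix k m z : qconj (slice_pt I z) ^+ k * slice_pt I z ^+ m =
  (zmix_re k m z)%:A + zmix_im k m z *: I.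
Proof.
rewrite qconj_slice_ptX slice_ptX /zmix_re /zmix_im.
move: (zpow k z).1 (zpow k z).2 (zpow m z).1 (zpow m z).2 => a b c d.
rewrite -scaleNr mulAI; congr (_%:A + _ *: I); ring.
Qed.

Lemma qabs_slice_pt z : qabs (slice_pt I z) ^+ 2 = z.1 ^+ 2 + z.2 ^+ 2.
Proof.
have [I0 I1] := imag_unitP hI.
rewrite -[z.2 ^+ 2 in RHS]mulr1 -[X in _ * X]I1.
by rewrite slice_ptE qabs_sqr !coordE I0; ring.
Qed.

Lemma gauss_weight_slice_pt z :
  gauss_weight (slice_pt I z) = pi^-1 * expR (- (z.1 ^+ 2 + z.2 ^+ 2)).
Proof. by rewrite /gauss_weight qabs_slice_pt. Qed.

End ComplexMoments.

(** * Quaternion-valued integrals *)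

Section QuaternionIntegral.
Context d (T : measurableType d) (R : realType) (mu : {measure set T -> \bar R}).
Local Notation H := (quaternion R).
Implicit Types (f : T -> H) (p q : H).

Lemma qintegralE f i : qintegral mu f 0 i = (\int[mu]_x f x 0 i)%R.
Proof. by rewrite mxE. Qed.

Lemma qintegrable_sum (I : Type) (s : seq I) (F : I -> T -> H) :
  (forall j, qintegrable mu (F j)) ->
  qintegrable mu (fun x => \sum_(j <- s) F j x) /\
  qintegral mu (fun x => \sum_(j <- s) F j x) = \sum_(j <- s) qintegral mu (F j).
Proof.
move=> Fi.
have h i : (fun x => (\sum_(j <- s) F j x) 0 i) = (fun x => \sum_(j <- s) F j x 0 i).
  by apply/funext => x; rewrite coord_sum.
split=> [i|].
  by under eq_fun do rewrite coord_sum; apply: integrableR_sum => j; exact: Fi.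
apply/rowP => i; rewrite qintegralE coord_sum.
under eq_Rintegral do rewrite coord_sum.
rewrite RintegralR_sum => [|j]; last exact: Fi.
by apply: eq_bigr => j _; rewrite qintegralE.
Qed.

Lemma qintegrable_linear (A : {linear H -> H}) f : qintegrable mu f ->
  qintegrable mu (fun x => A (f x)) /\
  qintegral mu (fun x => A (f x)) = A (qintegral mu f).
Proof.
move=> fi.
have AE p i : A p 0 i = \sum_(j < 4) A (basis_vec j) 0 i * p 0 j.
  rewrite {1}(quat_basis p) linear_sum coord_sum.
  by apply: eq_bigr => j _; rewrite linearZ /= coordZ mulrC.
split=> [i|].
  under eq_fun do rewrite AE.
  by apply: integrableR_sum => j; apply: integrableR_Z; exact: fi.
apply/rowP => i; rewrite qintegralE AE.
under eq_Rintegral do rewrite AE.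
rewrite RintegralR_sum => [|j]; last by apply: integrableR_Z; exact: fi.
apply: eq_bigr => j _; rewrite RintegralZl ?qintegralE//; exact: fi.
Qed.

Lemma qintegrable_sandwich p q f : qintegrable mu f ->
  qintegrable mu (fun x => p * f x * q) /\
  qintegral mu (fun x => p * f x * q) = p * qintegral mu f * q.
Proof.
have lin : linear (fun y : H => p * y * q).
  by move=> a u v; rewrite mulrDr mulrDl -!scalerAr -!scalerAl.
exact: (qintegrable_linear (HB.pack (fun y : H => p * y * q)
  (GRing.isLinear.Build _ _ _ _ (fun y : H => p * y * q) lin))).
Qed.

Lemma qintegral_dominated (F_ : nat -> T -> H) (F : T -> H) (g : T -> R) :
  (forall n i, measurable_fun setT (fun x => F_ n x 0 i)) ->
  (forall x, F_ ^~ x @ \oo --> F x) ->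
  (forall n x, `|F_ n x| <= g x) -> mu.-integrable setT (fun x => (g x)%:E) ->
  qintegrable mu F /\ qintegral mu (F_ n) @[n --> \oo] --> qintegral mu F.
Proof.
move=> mF cF Fg ig.
have h i := @Rintegral_dominated _ T R mu (fun n x => F_ n x 0 i) (fun x => F x 0 i) g
  (fun n => mF n i) (fun x => cvg_coord (i := i) (cF x))
  (fun n x => le_trans (coord_le_norm (F_ n x) i) (Fg n x)) ig.
split=> [i|]; first exact: (h _ i).1.
apply: cvg_quat => i; rewrite qintegralE.
by under eq_fun do rewrite qintegralE; exact: (h _ i).2.
Qed.

End QuaternionIntegral.

Section SquareIntegrable.
Context {R : realType}.
Local Notation H := (quaternion R).
Local Notation mu := (@lebesgue_measure R).
Local Notation s2 := (Num.sqrt 2 : R).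

Lemma bessel (f : R -> R) n : measurable_fun setT f ->
  mu.-integrable setT (fun x => (f x ^+ 2)%:E) ->
  \sum_(0 <= k < n) k`!%:R * (\int[mu]_x (nhermf k x * f x))%R ^+ 2 <=
  (\int[mu]_x (f x ^+ 2))%R.
Proof.
move=> mf f2; pose b k := (\int[mu]_x (nhermf k x * f x))%R.
have ief k : mu.-integrable setT (fun x => (nhermf k x * f x)%:E).
  apply: integrable_sq_mul => //; first exact: measurable_nhermf.
  by have := @integrable_nhermf_mul R k k; congr (mu.-integrable setT); apply/funext => x; rewrite expr2.
pose S x := \sum_(0 <= k < n) k`!%:R * b k * nhermf k x.
have SfE x : S x * f x = \sum_(0 <= k < n) k`!%:R * b k * (nhermf k x * f x).
  by rewrite /S mulr_suml; apply: eq_bigr => k _; ring.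
have SSE x : S x * S x = \sum_(0 <= k < n) \sum_(0 <= l < n)
    k`!%:R * b k * (l`!%:R * b l) * (nhermf k x * nhermf l x).
  rewrite /S mulr_suml; apply: eq_bigr => k _; rewrite mulr_sumr.
  by apply: eq_bigr => l _; ring.
have iSf : mu.-integrable setT (fun x => (S x * f x)%:E).
  by under eq_fun do rewrite SfE; apply: integrableR_sum => k; exact: integrableR_Z.
have iSS : mu.-integrable setT (fun x => (S x * S x)%:E).
  under eq_fun do rewrite SSE; apply: integrableR_sum => k; apply: integrableR_sum => l.
  by apply: integrableR_Z; exact: integrable_nhermf_mul.
have ISf : (\int[mu]_x (S x * f x))%R = \sum_(0 <= k < n) k`!%:R * b k ^+ 2.
  under eq_Rintegral do rewrite SfE.
  rewrite RintegralR_sum => [|k]; last exact: integrableR_Z.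
  by apply: eq_bigr => k _; rewrite (RintegralZl _ _ (ief k))// expr2 mulrA.
have ISS : (\int[mu]_x (S x * S x))%R = \sum_(0 <= k < n) k`!%:R * b k ^+ 2.
  under eq_Rintegral do rewrite SSE.
  have iZ k l := integrableR_Z (k`!%:R * b k * (l`!%:R * b l)) (@integrable_nhermf_mul R k l).
  rewrite RintegralR_sum => [|k]; last by apply: integrableR_sum => l; exact: iZ.
  apply: eq_big_nat => k kn.
  rewrite RintegralR_sum => [|l]; last exact: iZ.
  rewrite (bigD1_seq k) ?mem_index_iota ?iota_uniq//= big1 => [|l lk]; last first.
    rewrite RintegralZl//; last exact: integrable_nhermf_mul.
    by rewrite nhermf_ortho eq_sym (negbTE lk) mulr0.
  rewrite RintegralZl//; last exact: integrable_nhermf_mul.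
  rewrite nhermf_ortho eqxx addr0.
  have : k`!%:R != 0 :> R by rewrite pnatr_eq0 -lt0n fact_gt0.
  by move: (k`!%:R) => c c0; field.
rewrite -[leLHS]/(\sum_(0 <= k < n) k`!%:R * b k ^+ 2).
have : 0 <= (\int[mu]_x ((f x - S x) ^+ 2))%R.
  by apply: Rintegral_ge0 => x _; exact: sqr_ge0.
have -> : (fun x => (f x - S x) ^+ 2) = (fun x => f x ^+ 2 + S x * S x - 2 * (S x * f x)).
  by apply/funext => x; ring.
rewrite (RintegralB measurableT (integrableR_D f2 iSS) (integrableR_Z 2 iSf)).
rewrite (RintegralD measurableT f2 iSS) (RintegralZl _ measurableT iSf) ISf ISS.
rewrite -/b; move: (\int[mu]_x _)%R (\sum_(0 <= k < n) _) => A B h.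
by rewrite -subr_ge0; apply: le_trans h _; rewrite le_eqVlt; apply/orP; left; apply/eqP; ring.
Qed.

Variable phi : R -> H.
Hypothesis L2phi : L2H phi.

Let mphi i : measurable_fun setT (fun x => phi x 0 i). Proof. by case: L2phi. Qed.

Lemma measurable_qabs_L2H : measurable_fun setT (fun x => qabs (phi x)).
Proof.
apply: (measurableT_comp (f := @Num.sqrt R)).
  by apply: continuous_measurable_fun; exact: sqrt_continuous.
by apply: measurable_sum => i; exact: measurable_funX.
Qed.

Lemma integrable_L2H : mu.-integrable setT (fun x => (qabs (phi x) ^+ 2)%:E).
Proof.
apply/integrableP; split.
  by apply/measurable_EFinP; exact: (measurable_funX 2 measurable_qabs_L2H).
case: L2phi => _; congr (_ < _)%E; apply: eq_integral => x _ /=.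
by rewrite ger0_norm ?sqr_ge0.
Qed.

Lemma integrable_L2H_coord i : mu.-integrable setT (fun x => (phi x 0 i ^+ 2)%:E).
Proof.
apply: (integrable_le (mu := mu) _ _ integrable_L2H).
  exact: (measurable_funX 2 (mphi i)).
move=> x; rewrite ger0_norm ?sqr_ge0// -(real_normK (num_real (phi x 0 i))).
by rewrite ler_pXn2r ?nnegrE ?qabs_ge0//; exact: coord_le_qabs.
Qed.

Definition L2sqnorm : R := (\int[mu]_x (qabs (phi x) ^+ 2))%R.

Definition hermite_coef k : H := qintegral mu (fun x => nhermf k x *: phi x).

Lemma hermite_coefE k i : hermite_coef k 0 i = (\int[mu]_x (nhermf k x * phi x 0 i))%R.
Proof. by rewrite qintegralE; under eq_Rintegral do rewrite coordZ. Qed.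

Lemma bessel_L2H n :
  \sum_(0 <= k < n) k`!%:R * qabs (hermite_coef k) ^+ 2 <= L2sqnorm.
Proof.
have -> : L2sqnorm = \sum_(i < 4) (\int[mu]_x (phi x 0 i ^+ 2))%R.
  rewrite -RintegralR_sum => [|i]; last exact: integrable_L2H_coord.
  by apply: eq_Rintegral => x _; rewrite qabs_sqr sum_ord4.
apply: le_trans (_ : \sum_(i < 4) \sum_(0 <= k < n) k`!%:R * (\int[mu]_x (nhermf k x * phi x 0 i))%R ^+ 2 <= _); last first.
  by apply: ler_sum => i _; apply: bessel => //; exact: integrable_L2H_coord.
rewrite exchange_big /= le_eqVlt; apply/orP; left; apply/eqP.
apply: eq_bigr => k _; rewrite -mulr_sumr; congr (_ * _).
by rewrite qabs_sqr sum_ord4 !hermite_coefE.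
Qed.

Lemma L2sqnorm_ge0 : 0 <= L2sqnorm.
Proof. by apply: Rintegral_ge0 => x _; exact: sqr_ge0. Qed.

Lemma hermite_coef_le k : qabs (hermite_coef k) ^+ 2 <= L2sqnorm / k`!%:R.
Proof.
rewrite ler_pdivlMr ?ltr0n ?fact_gt0// mulrC.
apply: le_trans (bessel_L2H k.+1).
rewrite big_nat_recr //= lerDr sumr_ge0// => j _.
by rewrite mulr_ge0// sqr_ge0.
Qed.

Lemma entire_hermite_coef : entire hermite_coef.
Proof.
move=> r r0; exists (1 + L2sqnorm * expR (r ^+ 2)) => k.
have h := le_trans (ler_wpM2l (exprn_ge0 k r0) (norm_le_qabs (hermite_coef k))).
apply: h.
set t := _ * _.
have : t ^+ 2 <= L2sqnorm * expR (r ^+ 2).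
  rewrite exprMn; apply: le_trans (ler_wpM2l _ (hermite_coef_le k)) _; first exact: sqr_ge0.
  rewrite mulrCA ler_wpM2l ?L2sqnorm_ge0// -exprM mulnC exprM.
  by apply: exp_coeff_le; exact: sqr_ge0.
have := sqr_ge0 (t - 1); have := sqr_ge0 t; nra.
Qed.

End SquareIntegrable.

Lemma geometric_sum_le (R : realType) (r : R) n : 0 <= r < 1 ->
  \sum_(0 <= k < n) r ^+ k <= (1 - r)^-1.
Proof.
move=> /andP[r0 r1]; have r1' : 0 < 1 - r by rewrite subr_gt0.
rewrite -[leRHS]mul1r ler_pdivlMr// big_mkord mulrC -opprB mulNr.
by rewrite -subrX1 opprB lerBlDr lerDl exprn_ge0.
Qed.

Section HermiteSeries.
Context {R : realType}.
Local Notation H := (quaternion R).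
Local Notation mu := (@lebesgue_measure R).
Local Notation s2 := (Num.sqrt 2 : R).
Variables (phi : R -> H) (L2phi : L2H phi).

Lemma qintegrable_hermite_coef k : qintegrable mu (fun x => nhermf k x *: phi x).
Proof.
move=> i; under eq_fun do rewrite coordZ.
apply: integrable_sq_mul; first exact: measurable_nhermf.
- by case: L2phi => mphi _; exact: mphi.
- by have := @integrable_nhermf_mul R k k; congr (mu.-integrable setT); apply/funext => x; rewrite expr2.
- exact: integrable_L2H_coord.
Qed.

Definition nhermf_bound (r x : R) : R :=
  pi `^ (- 4^-1) * expR (- (x ^+ 2 / 2)) * expR (s2 * `|x| * r + r ^+ 2).

Lemma nhermf_bound_ge0 r x : 0 <= nhermf_bound r x.
Proof. by rewrite !mulr_ge0 ?expR_ge0 ?powR_ge0. Qed.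

Lemma measurable_nhermf_bound r : measurable_fun setT (nhermf_bound r).
Proof.
apply: measurable_funM.
  apply: measurable_funM => //; apply: measurableT_comp => //; apply: measurableT_comp => //.
  by apply: measurable_funM => //; exact: measurable_funX.
apply: measurableT_comp => //; apply: measurable_funD => //.
by apply: measurable_funM => //; apply: measurable_funM => //; exact: measurableT_comp.
Qed.

Lemma integrable_nhermf_bound_sq r :
  mu.-integrable setT (fun x => (nhermf_bound r x ^+ 2)%:E).
Proof.
pose T (x : R) := (pi `^ (- 4^-1)) ^+ 2 * expR (s2 * `|x| * r + r ^+ 2) ^+ 2 : R.
have tT : tempered1 T.
  split.
    apply: measurable_funM => //; apply: measurable_funX; apply: measurableT_comp => //.
    apply: measurable_funD => //; apply: measurable_funM => //.
    by apply: measurable_funM => //; exact: measurableT_comp.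
  exists ((pi `^ (- 4^-1)) ^+ 2 * expR (2 * r ^+ 2)), (2 * (s2 * r)) => x.
  have -> : `|T x| = T x by rewrite ger0_norm// /T mulr_ge0// sqr_ge0.
  rewrite /T -[leRHS]mulrA -expRD -expRM_natl.
  by rewrite ler_wpM2l ?sqr_ge0// ler_expR; apply: le_of_eq; ring.
have := tempered1_integrable_gauss tT.
congr (mu.-integrable setT); apply/funext => x.
have -> : expR (- x ^+ 2) = expR (- (x ^+ 2 / 2)) ^+ 2.
  by rewrite -expRM_natl; congr expR; field.
by rewrite /T /nhermf_bound; congr (_%:E); ring.
Qed.

Variables (u : nat -> H) (A C : R).
Hypotheses (C0 : 0 <= C) (uC : forall k, `|u k| <= A * C ^+ k).

Lemma hermite_series_cvg x : cvgn (series (fun k => u k * (nhermf k x)%:A)).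
Proof. exact: entire_mul_cvg (entire_nhermf x) C0 uC. Qed.

Lemma hermite_series_le n x : `|series (fun k => u k * (nhermf k x)%:A) n| <=
  2 * A * nhermf_bound (2 * C) x.
Proof.
have A0 : 0 <= A.
  by apply: le_trans (normr_ge0 (u 0%N)) _; apply: le_trans (uC 0%N) _; rewrite expr0 mulr1.
have K0 := nhermf_bound_ge0 (2 * C) x.
apply: le_trans (ler_norm_sum _ _ _) _.
have le k : `|u k * (nhermf k x)%:A| <= A * nhermf_bound (2 * C) x * 2^-1 ^+ k.
  rewrite -scalerAr mulr1 normrZ.
  have C20 : 0 <= 2 * C by rewrite mulr_ge0.
  apply: le_trans (ler_wpM2l (normr_ge0 _) (uC k)) _.
  have := ler_wpM2l A0 (nhermf_le k x C20).
  rewrite -/(nhermf_bound _ x) -[leRHS]/(A * nhermf_bound (2 * C) x).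
  have p2 : 0 < 2 ^+ k :> R by rewrite exprn_gt0.
  rewrite exprVn ler_pdivlMr// => h.
  by apply: le_trans h; apply: le_of_eq; rewrite exprMn; ring.
apply: le_trans (ler_sum _ (fun k _ => le k)) _.
rewrite -mulr_sumr; apply: le_trans (ler_wpM2l _ (geometric_sum_le (r := 2^-1) n _)) _.
- by rewrite mulr_ge0.
- by apply/andP; split; lra.
- by apply: le_of_eq; field.
Qed.

Lemma hermite_series_integral :
  qintegrable mu (fun x => limn (series (fun k => u k * (nhermf k x)%:A)) * phi x) /\
  series (fun k => u k * hermite_coef phi k) @ \oo -->
  qintegral mu (fun x => limn (series (fun k => u k * (nhermf k x)%:A)) * phi x).
Proof.
pose F n x : H := series (fun k => u k * (nhermf k x)%:A) n * phi x.
have FE n x : F n x = \sum_(0 <= k < n) u k * (nhermf k x *: phi x) * 1.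
  rewrite /F /series /= mulr_suml; apply: eq_bigr => k _.
  by rewrite mulr1 -!scalerAr -scalerAl mulr1.
have sw k := qintegrable_sandwich (u k) 1 (qintegrable_hermite_coef k).
have iF n : qintegrable mu (F n) /\
    qintegral mu (F n) = series (fun k => u k * hermite_coef phi k) n.
  have [h1 h2] := qintegrable_sum (index_iota 0 n) (fun k => (sw k).1).
  have -> : F n = fun x => \sum_(0 <= k < n) u k * (nhermf k x *: phi x) * 1.
    by apply/funext => x; exact: FE.
  split=> //; rewrite h2; apply: eq_bigr => k _.
  by rewrite (sw k).2 mulr1.
have A0 : 0 <= A.
  by apply: le_trans (normr_ge0 (u 0%N)) _; apply: le_trans (uC 0%N) _; rewrite expr0 mulr1.
have [||||i1 c1] := @qintegral_dominated _ _ R mu F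
  (fun x => limn (series (fun k => u k * (nhermf k x)%:A)) * phi x)
  (fun x => 8 * A * (nhermf_bound (2 * C) x * qabs (phi x))).
- by move=> n i; apply/measurable_EFinP; apply: measurable_int; exact: (iF n).1.
- by move=> x; apply: qcvgM; [exact: hermite_series_cvg|exact: cvg_cst].
- move=> n x; apply: le_trans (qnormM_le2 (hermite_series_le n x) (norm_le_qabs _)) _.
  by apply: le_of_eq; ring.
- apply: integrableR_Z; apply: integrable_sq_mul.
  + exact: measurable_nhermf_bound.
  + exact: measurable_qabs_L2H.
  + exact: integrable_nhermf_bound_sq.
  + exact: integrable_L2H.
split=> //.
have -> : series (fun k => u k * hermite_coef phi k) = fun n => qintegral mu (F n).
  by apply/funext => n; rewrite (iF n).2.
exact: c1.
Qed.

End HermiteSeries.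

(** * The Bargmann transform as a power series *)

Section BargmannSeries.
Context {R : realType}.
Local Notation H := (quaternion R).
Local Notation mu := (@lebesgue_measure R).
Implicit Types (p q : H) (a : nat -> H).

Lemma pser_slice_hyperholomorphic a : entire a -> slice_hyperholomorphic (pser a).
Proof.
move=> ea; split=> [q|I hI x y]; first by have [] := pser_is_diff q ea.
have I2 : I * I = -1 by rewrite -expr2.
set p := slice_pt I (x, y).
have pI : p * I = I * p.
  by rewrite /p slice_ptE// mulrDl mulrDr -!scalerAl -!scalerAr mul1r mulr1.
have dcurve (c e : H) (t s : R) : is_derive t 1 id (1 : R) ->
    is_diff t (fun s => s *: e + c) (fun s => (1 * s) *: e).
  move=> d; apply: is_diff_eq (is_diffD (is_diff_scale_curve e d) (is_diff_cst c t)) _.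
  by apply/funext => r; rewrite fctE addr0.
have D (e : H) (w : R -> H) (t : R) (c : H) : w = (fun s => s *: e + c) -> w t = p ->
    derive1 (fun s => pser a (w s)) t = limn (series (fun k => dpow k p e * a k)).
  move=> wE wt.
  have dw : is_diff t w (fun s => (1 * s) *: e) by rewrite wE; apply: dcurve => //; exact: is_derive_id.
  have [df dv] := is_diff_comp dw (pser_is_diff (w t) ea).
  by rewrite derive1E' // dv /= mul1r scale1r wt.
rewrite (D 1 _ _ (y *: I)); last 2 first.
- by apply/funext => s; rewrite slice_ptE.
- by [].
rewrite (D I _ _ (x%:A)); last 2 first.
- by apply/funext => s; rewrite slice_ptE// addrC.
- by [].
have h : series (fun k => dpow k p 1 * a k + I * (dpow k p I * a k)) @ \oo -->
    limn (series (fun k => dpow k p 1 * a k)) +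
    I * limn (series (fun k => dpow k p I * a k)).
  by apply: cvg_seriesD; [exact: dpow_cvg|apply: qcvg_seriesMl; exact: dpow_cvg].
apply/esym; apply: cvg_unique h => //.
have -> : (fun k => dpow k p 1 * a k + I * (dpow k p I * a k)) = fun=> 0.
  apply/funext => -[|k]; first by rewrite /= !mul0r mulr0 addr0.
  rewrite !dpow_comm ?mulr1 ?mul1r// mulrA -scalerAr mulrA I2 mulN1r.
  by rewrite scalerN mulNr addrN.
have -> : series (fun=> 0 : H) = fun=> 0.
  by apply/funext => n; rewrite /series /= big1.
exact: cvg_cst.
Qed.

Variables (phi : R -> H) (L2phi : L2H phi).

Let pow_le q k : `|q ^+ k| <= 1 * (16 * (`|q| + 1)) ^+ k.
Proof.
rewrite mul1r -[X in X ^+ k]addr0; apply: norm_pow_le => //.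
by rewrite normr0.
Qed.

Let B0 q : 0 <= 16 * (`|q| + 1). Proof. by rewrite mulr_ge0// addr_ge0. Qed.

Lemma bargmann_integrable q : qintegrable mu (fun x => bargmann_kernel q x * phi x).
Proof.
have [h _] := hermite_series_integral L2phi (B0 q) (pow_le q).
by under eq_fun do rewrite bargmann_kernelE.
Qed.

Lemma bargmannE : bargmann phi = pser (hermite_coef phi).
Proof.
apply/funext => q; have [_ h] := hermite_series_integral L2phi (B0 q) (pow_le q).
rewrite /pser (cvg_lim _ h)// /bargmann; congr qintegral; apply/funext => x.
by rewrite bargmann_kernelE.
Qed.

Lemma bargmann_slice_hyperholomorphic : slice_hyperholomorphic (bargmann phi).
Proof.
by rewrite bargmannE; apply: pser_slice_hyperholomorphic; exact: entire_hermite_coef.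
Qed.

Lemma bargmann_has_laplacian : has_laplacian (bargmann phi).
Proof. by rewrite bargmannE; apply: pser_has_laplacian; exact: entire_hermite_coef. Qed.

Lemma SHE q : SH phi q = limn (series (fun k => lap k q * hermite_coef phi k)).
Proof.
rewrite /SH /= /fueter bargmannE pser_laplacian//; exact: entire_hermite_coef.
Qed.

Lemma Phi_term_series q x : cvgn (series (Phi_term q x)) /\
  Phi q x = limn (series (fun k => lap k q * (nhermf k x)%:A)).
Proof.
set c : R := pi `^ (- 4^-1).
have c0 : c != 0 by rewrite gt_eqF// powR_gt0// pi_gt0.
have hl := hermite_series_cvg (x := x) (B0 q) (fun k => norm_lap_le k q).
set l := limn _ in hl *.
have hs : series (fun k => lap k.+2 q * (nhermf k.+2 x)%:A) @ \oo --> l.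
  have -> : series (fun k => lap k.+2 q * (nhermf k.+2 x)%:A) =
      fun n => series (fun k => lap k q * (nhermf k x)%:A) n.+2.
    apply/funext => n; rewrite /series /= !big_nat_recl//.
    by rewrite lap0 lap1 !mul0r !add0r.
  by move: hl; rewrite -cvg_shiftS -cvg_shiftS.
have hP : series (Phi_term q x) @ \oo --> - c^-1 *: l.
  have -> : Phi_term q x = fun k => - c^-1 *: (lap k.+2 q * (nhermf k.+2 x)%:A).
    by apply/funext => k; rewrite Phi_term_lap scalerA mulrNN mulVf// scale1r.
  exact: cvg_seriesZ hs.
split; first by apply: cvgP hP.
rewrite /Phi (cvg_lim _ hP)// scalerA -scaleNr mulrN opprK -powRN -/c mulfV//.
by rewrite scale1r.
Qed.

Lemma Phi_integral q :
  qintegrable mu (fun x => Phi q x * phi x) /\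
  qintegral mu (fun x => Phi q x * phi x) = SH phi q.
Proof.
have [h1 h2] := hermite_series_integral L2phi (B0 q) (fun k => norm_lap_le k q).
have E : (fun x => Phi q x * phi x) =
    (fun x => limn (series (fun k => lap k q * (nhermf k x)%:A)) * phi x).
  by apply/funext => x; rewrite (Phi_term_series q x).2.
by rewrite E SHE (cvg_lim _ h2).
Qed.

End BargmannSeries.

(** * The Fock-Fueter transform *)

Section FockSpace.
Context {R : realType}.
Local Notation H := (quaternion R).
Local Notation mu2 := (@lebesgue2 R).
Implicit Types (p q : H) (k m n : nat) (z : R * R).
Variables (I : H) (hI : imag_units I).

Let mix k m z : H := gauss_weight (slice_pt I z) *:
  (qconj (slice_pt I z) ^+ k * slice_pt I z ^+ m).

Lemma gauss_moment k m : qintegrable mu2 (mix k m) /\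
  qintegral mu2 (mix k m) = if k == m then (k`!%:R : R)%:A else 0.
Proof.
have [t1 t2] := @tempered2_zmix R k m.
have i1 := tempered2_integrable_gauss t1; have i2 := tempered2_integrable_gauss t2.
have E i z : mix k m z 0 i =
    pi^-1 * (1 : H) 0 i * (zmix_re k m z * expR (- (z.1 ^+ 2 + z.2 ^+ 2))) +
    pi^-1 * I 0 i * (zmix_im k m z * expR (- (z.1 ^+ 2 + z.2 ^+ 2))).
  rewrite /mix slice_pt_mix// gauss_weight_slice_pt// coordZ coordD !coordZ.
  by ring.
split=> [i|].
  by under eq_fun do rewrite E; apply: integrableR_D; exact: integrableR_Z.
apply/rowP => i; rewrite qintegralE; under eq_Rintegral do rewrite E.
rewrite (RintegralD measurableT (integrableR_Z _ i1) (integrableR_Z _ i2)).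
rewrite (RintegralZl _ measurableT i1) (RintegralZl _ measurableT i2).
rewrite -![Rintegral _ _ _]/(gauss_int2 _).
have [-> ->] := @gauss_int2_zmix R k m.
have p0 : pi != 0 :> R by rewrite gt_eqF// pi_gt0.
rewrite [X in _ + X]mulr0 addr0; case: ifP => _; last by rewrite mulr0 qcoord0.
by rewrite coordZ mulrAC mulrCA mulVf// mulr1 mulrC.
Qed.

Lemma qabs_slice_pt_le z : qabs (slice_pt I z) <= norm1 z.
Proof.
rewrite -(@ler_pXn2r _ 2) ?nnegrE ?qabs_ge0 ?norm1_ge0// qabs_slice_pt// /norm1.
rewrite -(real_normK (num_real z.1)) -(real_normK (num_real z.2)).
by have := mulr_ge0 (normr_ge0 z.1) (normr_ge0 z.2); lra.
Qed.

Variables (phi : R -> H) (L2phi : L2H phi).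
Local Notation a := (hermite_coef phi).

Definition bargmann_partial n p : H := series (fun k => p ^+ k * a k) n.

Lemma bargmann_partial_le n p : `|bargmann_partial n p| <=
  5 * Num.sqrt (L2sqnorm phi) * expR (25 / 32 * qabs p ^+ 2).
Proof.
have N0 := L2sqnorm_ge0 phi.
have le k : `|p ^+ k * a k| <=
    Num.sqrt (L2sqnorm phi) * expR (25 / 32 * qabs p ^+ 2) * (4 / 5) ^+ k.
  apply: le_trans (norm_le_qabs _) _; rewrite qabsM qabsX.
  have r0 : 0 <= (4 / 5 : R) ^+ k by rewrite exprn_ge0// divr_ge0.
  have lhs0 : 0 <= qabs p ^+ k * qabs (a k) by rewrite mulr_ge0 ?exprn_ge0 ?qabs_ge0.
  have rhs0 : 0 <= Num.sqrt (L2sqnorm phi) * expR (25 / 32 * qabs p ^+ 2) * (4 / 5) ^+ k.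
    by rewrite !mulr_ge0 ?expR_ge0 ?sqrtr_ge0.
  rewrite -(@ler_pXn2r _ 2) ?nnegrE//.
  rewrite [leLHS]exprMn [leRHS]exprMn (exprMn 2 (Num.sqrt (L2sqnorm phi))) (sqr_sqrtr N0) -expRM_natl.
  apply: le_trans (ler_wpM2l (sqr_ge0 _) (hermite_coef_le L2phi k)) _.
  have u0 : 0 <= 25 / 16 * qabs p ^+ 2 by rewrite mulr_ge0 ?sqr_ge0// divr_ge0.
  have := ler_wpM2l (mulr_ge0 N0 (sqr_ge0 ((4 / 5 : R) ^+ k))) (exp_coeff_le k u0).
  have -> : 2%:R * (25 / 32 * qabs p ^+ 2) = 25 / 16 * qabs p ^+ 2 by field.
  move=> h; apply: le_trans (le_trans _ h) _; last by apply: le_of_eq; rewrite !exprMn; ring.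
  apply: le_of_eq; rewrite [(25 / 16 * _) ^+ k]exprMn.
  have -> : ((qabs p ^+ k) ^+ 2) = (qabs p ^+ 2) ^+ k by rewrite -!exprM mulnC.
  have e : ((4 / 5 : R) ^+ k) ^+ 2 * (25 / 16) ^+ k = 1.
    by rewrite -exprM mulnC exprM -exprMn (_ : _ * _ = 1) ?expr1n//; field.
  rewrite -[LHS]mulr1 -[X in _ * X = _]e; ring.
apply: le_trans (ler_norm_sum _ _ _) _.
apply: le_trans (ler_sum _ (fun k _ => le k)) _.
rewrite -mulr_sumr; apply: le_trans (ler_wpM2l _ (geometric_sum_le (r := 4 / 5) n _)) _.
- by rewrite mulr_ge0 ?expR_ge0 ?sqrtr_ge0.
- by apply/andP; split; lra.
- by apply: le_of_eq; field.
Qed.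

Lemma bargmann_partial_cvg p : bargmann_partial n p @[n --> \oo] --> bargmann phi p.
Proof. rewrite bargmannE//; exact: pser_cvg (entire_hermite_coef L2phi). Qed.

Lemma entire_fock_coef p : entire (fun k => (k`!%:R)^-1 *: qconj p ^+ k : H).
Proof.
apply: entire_scaled_fact; exists (qabs p), 1; split=> [|k]; first exact: qabs_ge0.
rewrite mul1r normrZ ger0_norm ?invr_ge0// mulrC ler_wpM2r ?invr_ge0//.
by apply: le_trans (norm_le_qabs _) _; rewrite qabsX qabsJ.
Qed.

Lemma fock_fueter_kernelE q p : fock_fueter_kernel q p =
  limn (series (fun k => lap k q * ((k`!%:R)^-1 *: qconj p ^+ k))).
Proof.
have E : (fun r => fock_kernel r p) = pser (fun k => (k`!%:R)^-1 *: qconj p ^+ k).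
  apply/funext => r; rewrite /fock_kernel /pser; congr (limn (series _)).
  by apply/funext => k; rewrite scalerAr.
by rewrite /fock_fueter_kernel E pser_laplacian//; exact: entire_fock_coef.
Qed.

Definition fock_kernel_partial q n p : H :=
  series (fun k => lap k q * ((k`!%:R)^-1 *: qconj p ^+ k)) n.

Lemma fock_kernel_partial_le q n p : `|fock_kernel_partial q n p| <=
  16 * expR (16 * (`|q| + 1) * qabs p).
Proof.
have B0 : 0 <= 16 * (`|q| + 1) by rewrite mulr_ge0// addr_ge0.
have Bp0 : 0 <= 16 * (`|q| + 1) * qabs p by rewrite mulr_ge0// qabs_ge0.
have le k : `|lap k q * ((k`!%:R)^-1 *: qconj p ^+ k)| <=
    16 * exp_coeff (16 * (`|q| + 1) * qabs p) k.
  have hp : `|(k`!%:R)^-1 *: qconj p ^+ k| <= (k`!%:R)^-1 * qabs p ^+ k.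
    rewrite normrZ ger0_norm ?invr_ge0// ler_wpM2l ?invr_ge0//.
    by apply: le_trans (norm_le_qabs _) _; rewrite qabsX qabsJ.
  apply: le_trans (qnormM_le2 (norm_lap_le k q) hp) _.
  by apply: le_of_eq; rewrite /exp_coeff /= [in RHS]exprMn; ring.
apply: le_trans (ler_norm_sum _ _ _) _.
apply: le_trans (ler_sum _ (fun k _ => le k)) _.
rewrite -mulr_sumr ler_wpM2l//.
apply: nondecreasing_cvgn_le; last exact: is_cvg_series_exp_coeff.
by apply: nondecreasing_series => j _ _; rewrite /exp_coeff /= divr_ge0 ?exprn_ge0.
Qed.

Lemma fock_kernel_partial_cvg q p :
  fock_kernel_partial q n p @[n --> \oo] --> fock_fueter_kernel q p.
Proof. rewrite fock_fueter_kernelE; exact: lap_cvg (entire_fock_coef p). Qed.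

Let sandwich_moments (L M : nat -> H) n :
  qintegrable mu2 (fun z => \sum_(0 <= k < n) \sum_(0 <= m < n) L k * mix k m z * M m) /\
  qintegral mu2 (fun z => \sum_(0 <= k < n) \sum_(0 <= m < n) L k * mix k m z * M m) =
  \sum_(0 <= k < n) k`!%:R *: (L k * M k).
Proof.
have sw k m := qintegrable_sandwich (L k) (M m) (gauss_moment k m).1.
have sw2 k := qintegrable_sum (index_iota 0 n) (fun m => (sw k m).1).
have [h1 h2] := qintegrable_sum (index_iota 0 n) (fun k => (sw2 k).1).
split=> //; rewrite h2; apply: eq_big_nat => k kn.
rewrite (sw2 k).2 (bigD1_seq k) ?mem_index_iota ?iota_uniq//= big1 => [|m mk].
  by rewrite addr0 (sw k k).2 (gauss_moment k k).2 eqxx -scalerAr mulr1 -scalerAl.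
by rewrite (sw k m).2 (gauss_moment k m).2 eq_sym (negbTE mk) mulr0 mul0r.
Qed.

Lemma fock_fueter_bargmann q :
  qintegrable mu2 (fock_fueter_integrand I (bargmann phi) q) /\
  fock_fueter I (bargmann phi) q = SH phi q.
Proof.
have N0 := L2sqnorm_ge0 phi.
pose B := 16 * (`|q| + 1).
have B0 : 0 <= B by rewrite mulr_ge0// addr_ge0.
pose F n z : H := gauss_weight (slice_pt I z) *:
  (fock_kernel_partial q n (slice_pt I z) * bargmann_partial n (slice_pt I z)).
have FE n : F n = fun z => \sum_(0 <= k < n) \sum_(0 <= m < n)
    ((k`!%:R)^-1 *: lap k q) * mix k m z * a m.
  apply/funext => z; rewrite /F /fock_kernel_partial /bargmann_partial /series /=.
  rewrite mulr_suml scaler_sumr; apply: eq_bigr => k _.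
  rewrite mulr_sumr scaler_sumr; apply: eq_bigr => m _.
  by rewrite /mix -!scalerAr -!scalerAl !mulrA.
have iF n : qintegrable mu2 (F n) /\
    qintegral mu2 (F n) = series (fun k => lap k q * a k) n.
  rewrite FE; have [h1 h2] := sandwich_moments (fun k => (k`!%:R)^-1 *: lap k q) a n.
  split=> //; rewrite h2; apply: eq_bigr => k _.
  by rewrite -scalerAl scalerA mulfV ?scale1r// pnatr_eq0 -lt0n fact_gt0.
pose K : R := pi^-1 * (4 * 16 * (5 * Num.sqrt (L2sqnorm phi))).
have tB : tempered2 (fun z : R * R => expR (B * norm1 z)).
  split; last by exists 1, B => z; rewrite mul1r ger0_norm ?expR_ge0.
  apply: measurableT_comp => //; apply: measurable_funM => //.
  by apply: measurable_funD; apply: measurableT_comp.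
have a0 : 0 < 7 / 32 :> R by rewrite divr_gt0.
have [||||i1 c1] := @qintegral_dominated _ _ R mu2 F (fock_fueter_integrand I (bargmann phi) q)
  (fun z => K * (expR (B * norm1 z) * expR (- (7 / 32 * (z.1 ^+ 2 + z.2 ^+ 2))))).
- by move=> n i; apply/measurable_EFinP; apply: measurable_int; exact: (iF n).1.
- move=> z; apply: cvgZl_tmp; apply: qcvgM; first exact: fock_kernel_partial_cvg.
  exact: bargmann_partial_cvg.
- move=> n z; rewrite /F normrZ gauss_weight_slice_pt//.
  have pi0 : 0 <= (pi : R)^-1 by rewrite invr_ge0 pi_ge0.
  rewrite ger0_norm; last by rewrite mulr_ge0 ?expR_ge0.
  have k1 : `|fock_kernel_partial q n (slice_pt I z)| <= 16 * expR (B * norm1 z).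
    apply: le_trans (fock_kernel_partial_le _ _ _) _.
    by rewrite ler_wpM2l// ler_expR ler_wpM2l// qabs_slice_pt_le.
  have k2 := bargmann_partial_le n (slice_pt I z).
  have := qnormM_le2 k1 k2; rewrite qabs_slice_pt// => k3.
  apply: le_trans (ler_wpM2l _ k3) _; first by rewrite mulr_ge0 ?expR_ge0.
  have -> : - (7 / 32 * (z.1 ^+ 2 + z.2 ^+ 2)) =
      - (z.1 ^+ 2 + z.2 ^+ 2) + 25 / 32 * (z.1 ^+ 2 + z.2 ^+ 2) by field.
  by rewrite expRD /K; apply: le_of_eq; ring.
- by apply: integrableR_Z; exact: (tempered2_integrable a0 tB).
split=> //; rewrite SHE// /fock_fueter; apply/esym/cvg_lim => //.
have -> : series (fun k => lap k q * a k) = fun n => qintegral mu2 (F n).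
  by apply/funext => n; rewrite (iF n).2.
exact: c1.
Qed.

Let qconj_sum (s : seq nat) (u : nat -> H) :
  qconj (\sum_(k <- s) u k) = \sum_(k <- s) qconj (u k).
Proof.
elim: s => [|k s IH]; last by rewrite !big_cons qconjD IH.
by rewrite !big_nil; apply: quatP; rewrite !coordE ?oppr0.
Qed.

Lemma bargmann_slice_fock_norm :
  (\int[mu2]_z (gauss_weight (slice_pt I z) *
     qabs (bargmann phi (slice_pt I z)) ^+ 2)%:E <= (L2sqnorm phi)%:E)%E.
Proof.
pose G n z : R := gauss_weight (slice_pt I z) * qabs (bargmann_partial n (slice_pt I z)) ^+ 2.
pose S n z : H := \sum_(0 <= k < n) \sum_(0 <= m < n) qconj (a k) * mix k m z * a m.
have GE n z : G n z = S n z 0 0.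
  rewrite /G qabs_sqrE -coordZ; congr (_ _ 0 0).
  rewrite /S /bargmann_partial /series /= qconj_sum mulr_suml scaler_sumr.
  apply: eq_bigr => k _; rewrite mulr_sumr scaler_sumr; apply: eq_bigr => m _.
  by rewrite qconjM qconjX /mix -!scalerAr -!scalerAl !mulrA.
have iG n : mu2.-integrable setT (fun z => (G n z)%:E).
  by under eq_fun do rewrite GE; exact: (sandwich_moments (fun k => qconj (a k)) a n).1.
have IG n : (\int[mu2]_z (G n z)%:E <= (L2sqnorm phi)%:E)%E.
  rewrite -(fineK (integrable_fin_num measurableT (iG n))) lee_fin.
  rewrite -[leLHS]/(Rintegral mu2 setT (G n)).
  have -> : G n = fun z => S n z 0 0 by apply/funext => z; exact: GE.
  rewrite -qintegralE (sandwich_moments (fun k => qconj (a k)) a n).2 coord_sum.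
  apply: le_trans (bessel_L2H L2phi n); apply: le_of_eq; apply: eq_bigr => k _.
  by rewrite coordZ qabs_sqrE.
have cG z : (G n z)%:E @[n --> \oo] -->
    (gauss_weight (slice_pt I z) * qabs (bargmann phi (slice_pt I z)) ^+ 2)%:E.
  apply/fine_cvgP; split; first exact: nearW.
  apply: cvgM; first exact: cvg_cst.
  have cc i := cvg_coord (i := i) (bargmann_partial_cvg (p := slice_pt I z)).
  rewrite qabs_sqr; under eq_fun do rewrite /= qabs_sqr.
  have cX i : (bargmann_partial n (slice_pt I z) 0 i) ^+ 2 @[n --> \oo] -->
      (bargmann phi (slice_pt I z) 0 i) ^+ 2.
    by rewrite expr2; under eq_fun do rewrite expr2; apply: cvgM; exact: cc.
  by apply: cvgD; [apply: cvgD; [apply: cvgD|]|]; exact: cX.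
have G0 n z : (0 <= (G n z)%:E)%E.
  rewrite lee_fin /G; apply: mulr_ge0; last exact: sqr_ge0.
  by rewrite gauss_weight_slice_pt// mulr_ge0 ?expR_ge0// invr_ge0 pi_ge0.
have mG n : measurable_fun setT (fun z => (G n z)%:E) by exact: (measurable_int mu2 (iG n)).
have := @fatou _ _ R mu2 setT measurableT (fun n z => (G n z)%:E) mG (fun n z _ => G0 n z).
have -> : (\int[mu2]_z limn_einf (fun n => (G n z)%:E) = \int[mu2]_z
    (gauss_weight (slice_pt I z) * qabs (bargmann phi (slice_pt I z)) ^+ 2)%:E)%E.
  by apply: eq_integral => z _; exact: (cvg_limn_einf_sup (cG z)).1.
move/le_trans; apply; rewrite limn_einf_lim; apply: lime_le; first exact: is_cvg_einfs.
apply: nearW => n; apply: le_trans (IG n).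
by apply: ereal_inf_lbound; exists n => /=.
Qed.

End FockSpace.

Lemma bargmann_slice_fock (R : realType) (phi : R -> quaternion R) :
  L2H phi -> slice_fock (bargmann phi).
Proof.
move=> L2phi; split; first exact: bargmann_slice_hyperholomorphic.
move=> I hI; apply: le_lt_trans (bargmann_slice_fock_norm hI L2phi) _.
exact: ltry.
Qed.

Theorem theorem4p14 (R : realType) :
  (* S_H = tau o Id o B_H is a well defined map L^2 -> F_Slice -> SR -> A *)
  (forall phi : R -> quaternion R, L2H phi ->
     [/\ forall q, qintegrable lebesgue_measure
                     (fun x => bargmann_kernel q x * phi x),
         slice_fock (bargmann phi),
         has_laplacian (bargmann phi)
       & fueter_range (SH phi)]) /\
  (* it is the Bargmann-Fock-Fueter transform, with integral kernel Phi *)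
  (forall phi : R -> quaternion R, L2H phi ->
   forall I : quaternion R, imag_units I ->
   forall q : quaternion R,
     [/\ qintegrable lebesgue2 (fock_fueter_integrand I (bargmann phi) q),
         forall x : R, cvgn (series (Phi_term q x)),
         qintegrable lebesgue_measure (fun x => Phi q x * phi x),
         SH phi q = bargmann_fock_fueter I phi q
       & bargmann_fock_fueter I phi q
         = qintegral lebesgue_measure (fun x => Phi q x * phi x)]).
Proof.
split=> phi L2phi.
  split; [exact: bargmann_integrable|exact: bargmann_slice_fock| |].
    exact: bargmann_has_laplacian.
  by exists (bargmann phi); first exact: bargmann_slice_fock.
move=> I hI q.
have [iK eK] := fock_fueter_bargmann hI L2phi q.
have [iP eP] := Phi_integral L2phi q.
split=> //; first by move=> x; exact: (Phi_term_series q x).1.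
by rewrite /bargmann_fock_fueter eK eP.
Qed.
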